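(* For $\alpha>0$ let $h_0(\alpha)$ be the smallest positive zero of $$H_\alpha(z):=\sum_{k=0}^\infty \frac{(-z)^k}{k!\prod_{j=1}^k\big(j-\frac{1}{1+\alpha}\big)}.$$ Then $$\|T_\alpha\|_{2,2}=\frac{1}{1+\alpha}\sqrt{\frac{\alpha}{h_0(\alpha)}}.$$ Moreover, $$\|T_\alpha\|_{2,2}\sim \frac{1/\sqrt{h_0(\infty)}}{\sqrt{\alpha}}\quad\text{as }\alpha\to\infty,\qquad \|T_\alpha-T_0\|_{2,2}\sim\sqrt{\alpha/h_0(\infty)}\quad\text{as }\alpha\to 0,$$ where $h_0(\infty)=1.445796\ldots$ is the smallest positive zero of $H_\infty(z)=\sum_{k=0}^\infty\frac{(-z)^k}{(k!)^2}$, and $$\|T_\alpha\|_{2,2}=1-\frac34\alpha+O(\alpha^2)\quad\text{as }\alpha\to 0.$$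
   Context: For real $\alpha\ge 0$, $T_\alpha\colon L^2[0,1]\to L^2[0,1]$ is the bounded linear operator $(T_\alpha f)(x):=\int_0^{x^\alpha} f(y)\,dy$; for $\alpha=0$ this is $(T_0f)(x)=\int_0^1 f(y)\,dy$. $\|\cdot\|_{2,2}$ is the operator norm on $L^2[0,1]$. $f\sim g$ means $f/g\to 1$; $\alpha\to 0$ means $\alpha\to 0^+$; empty products equal $1$. *)

(* Defs.v *)
From HB Require Import structures.
From mathcomp Require Import all_boot all_order all_algebra.
From mathcomp Require Import all_classical all_reals all_analysis.
From mathcomp Require Import measurable_realfun.

Set Implicit Arguments.
Unset Strict Implicit.
Unset Printing Implicit Defensive.
Import Order.TTheory GRing.Theory Num.Theory.
Import numFieldNormedType.Exports.
Local Open Scope classical_set_scope.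
Local Open Scope ring_scope.

Definition mu01 (R : realType) :=
  mrestr (@lebesgue_measure R) (measurable_itv `[0 : R, 1]).
Arguments mu01 R _ : clear implicits.
HB.instance Definition _ (R : realType) := Measure.on (mu01 R).

(* L^2[0, 1] before the quotient by a.e. equality, on which the library has no
   module structure: the square-integrable functions, with their L^2 seminorm.
   The operator T below factors through the quotient (lemma T_ae_eq), so
   working with representatives does not change any operator norm. *)
Definition L2 (R : realType) := LfunType (mu01 R) (lee1n 2).
HB.instance Definition _ (R : realType) := GRing.Lmodule.on (L2 R).

Definition L2norm (R : realType) (f : L2 R) : \bar R :=
  'N[mu01 R]_2%:E[EFin \o (f : measurableTypeR R -> R)]%E.

Definition opnorm (R : realType) (A : L2 R -> L2 R) : \bar R :=
  ereal_sup [set L2norm (A f) | f in [set f : L2 R | (L2norm f <= 1)%E]].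

(* mu01 is used rather than lebesgue_measure: f may not be
   integrable outside [0, 1]. Only the x in [0, 1] matter; note 0 `^ 0 = 1. *)
Definition Tfun (R : realType) (a : R) (f : R -> R) (x : R) : R :=
  \int[mu01 R]_(y in `[0, x `^ a]) f y.

Section operator.
Context {R : realType}.
Implicit Types (a : R) (f g : L2 R).

Lemma mu01_setT : mu01 R setT = 1%E.
Proof.
rewrite /mu01 /mrestr setTI lebesgue_measure_itv/= lte_fin ltr01.
by rewrite oppr0 adde0.
Qed.

Lemma L2_integrable f (D : set (measurableTypeR R)) : measurable D ->
  (mu01 R).-integrable D (EFin \o f).
Proof.
have finT : mu01 R setT \is a fin_num by rewrite mu01_setT.
move=> mD; apply: (integrableS measurableT) => //.
by apply/Lfun1_integrable/(Lfun_subset12 finT); exact: LfunP.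
Qed.

Let measurable_0t (t : R) : measurable (`[0, t] : set (measurableTypeR R)).
Proof. exact: measurable_itv. Qed.

Lemma Tfun_measurable a f : measurable_fun setT (Tfun a f).
Proof.
pose F (g : R -> R) t := \int[mu01 R]_(y in `[0, t]) g y.
have mF (g : R -> R) : (forall y, 0 <= g y) ->
    (mu01 R).-integrable setT (EFin \o g) -> measurable_fun setT (F g).
  move=> g0 ig; apply: nondecreasing_measurable => // s t st.
  apply: fine_le.
  - apply: integrable_fin_num => //.
    by apply: (integrableS measurableT).
  - apply: integrable_fin_num => //.
    by apply: (integrableS measurableT).
  - apply: ge0_subset_integral => //.
    + by apply: measurable_funTS; case/integrableP : ig.
    + by move=> y _; rewrite lee_fin.
    + by apply: subset_itvl; rewrite bnd_simp.
have iT := L2_integrable f measurableT.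
have ip := integrable_funrpos measurableT iT.
have iN := integrable_funrneg measurableT iT.
have TE x : Tfun a f x = F (f : R -> R)^\+ (x `^ a) - F (f : R -> R)^\- (x `^ a).
  rewrite /Tfun /F -RintegralB//; last 2 first.
  - exact: (integrableS measurableT).
  - exact: (integrableS measurableT).
  by apply: eq_Rintegral => y _; rewrite -[in LHS](funrposBneg f).
have mx : measurable_fun setT (fun x : R => x `^ a) by exact: measurable_powR.
rewrite (_ : Tfun a f = (F (f : R -> R)^\+ \o (fun x => x `^ a)) \-
    (F (f : R -> R)^\- \o (fun x => x `^ a))); last exact/funext.
by apply: measurable_funB; apply: (measurableT_comp _ mx); apply: mF.
Qed.

Lemma Tfun_bound a f x :
  `|Tfun a f x| <= \int[mu01 R]_y `|f y|.
Proof.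
have mD : measurable (`[0, x `^ a] : set (measurableTypeR R)) by [].
apply: le_trans (le_normr_Rintegral _ _) _ => //; first exact: L2_integrable.
apply: fine_le.
- apply: integrable_fin_num => //; apply: integrable_norm.
  exact: L2_integrable.
- apply: integrable_fin_num => //; apply: integrable_norm.
  exact: L2_integrable.
- by apply: ge0_subset_integral => //; apply/measurable_EFinP; exact: measurableT_comp.
Qed.

Lemma Tfun_Lfun a f : (Tfun a f : measurableTypeR R -> R) \in Lfun (mu01 R) 2%:E.
Proof.
set M := \int[mu01 R]_y `|f y|.
rewrite inE; apply/andP; split; rewrite inE/=; first exact: Tfun_measurable.
rewrite /finite_norm unlock; apply: poweR_lty.
apply: (@le_lt_trans _ _ (\int[mu01 R]_x (M `^ 2)%:E)%E).
  apply: ge0_le_integral => //=.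
  - apply/measurable_EFinP; apply: (@measurableT_comp _ _ _ _ _ _ (@powR R ^~ 2)) => //.
    by apply: measurableT_comp => //; exact: Tfun_measurable.
  - move=> x _; rewrite lee_fin ge0_ler_powR// ?nnegrE//.
    + by apply: le_trans (Tfun_bound a f x).
    + exact: Tfun_bound.
by rewrite integral_cst// [X in (_ * X)%E]mu01_setT mule1 ltry.
Qed.

Definition T a f : L2 R := Lfun_Sub (lee1n 2) (Tfun_Lfun a f).

Lemma T_linear a : linear (T a).
Proof.
move=> k f g; apply/LfuneqP => x /=.
have mD : measurable (`[0, x `^ a] : set (measurableTypeR R)) by [].
have kf := L2_integrable (k *: f) mD.
transitivity (\int[mu01 R]_(y in `[0, x `^ a]) (k * f y) + Tfun a g x).
  by rewrite /Tfun -RintegralD//; exact: L2_integrable.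
by congr (_ + _); rewrite RintegralZl//; exact: L2_integrable.
Qed.

HB.instance Definition _ a := GRing.isLinear.Build R (L2 R) (L2 R) _ (T a) (T_linear a).

Lemma T_ae_eq a f g : ae_eq (mu01 R) setT (f : _ -> R) g -> T a f = T a g.
Proof.
move=> fg; apply/LfuneqP => x /=; rewrite /Tfun /Rintegral; congr fine.
have mfun (h : L2 R) (D : set (measurableTypeR R)) : measurable_fun D (EFin \o h).
  by apply/measurable_EFinP; apply: measurable_funTS.
apply: ae_eq_integral => //; [exact: mfun|exact: mfun|].
by apply: (ae_eq_subset (@subsetT _ _)); exact: (ae_eq_comp EFin fg).
Qed.
End operator.

Definition H (R : realType) (a z : R) : R :=
  limn (series (fun k =>
    (- z) ^+ k / (k`!%:R * \prod_(1 <= j < k.+1) (j%:R - (1 + a)^-1)))).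

Definition Hoo (R : realType) (z : R) : R :=
  limn (series (fun k => (- z) ^+ k / k`!%:R ^+ 2)).

(* H and Hoo are limits of convergent series, not default values of [limn]. *)
Lemma H_cvg (R : realType) (a z : R) : 0 < a ->
  cvgn (series (fun k =>
    (- z) ^+ k / (k`!%:R * \prod_(1 <= j < k.+1) (j%:R - (1 + a)^-1)))).
Proof.
move=> a0; set c := (1 + a)^-1.
have c1 : c < 1 by rewrite invf_lt1 ?ltrDl// addr_gt0.
have c0 : 0 < c by rewrite invr_gt0 addr_gt0.
have c1' : 0 < 1 - c by rewrite subr_gt0.
have P k : 1 - c <= \prod_(1 <= j < k.+1) (j%:R - c).
  elim: k => [|[|k] IH]; first by rewrite big_geq// gerBl ltW.
    by rewrite big_nat1.
  rewrite big_nat_recr//= -[1 - c]mulr1; apply: ler_pM => //; first exact: ltW.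
  by rewrite lerBrDr -natr1 [_ + 1]addrC lerD// (le_trans (ltW c1))// ler1n.
apply: normed_cvg; apply: (@series_le_cvg _ _ ((1 - c)^-1 *: exp_coeff `|z|)).
- by move=> k /=.
- by move=> k; rewrite /= mulr_ge0 ?invr_ge0 ?(ltW c1')// divr_ge0.
- move=> k; have Pk := lt_le_trans c1' (P k).
  rewrite /= normrM normfV normrX normrN normrM (gtr0_norm Pk) normr_nat.
  rewrite -[X in _ <= X]/((1 - c)^-1 * (`|z| ^+ k / k`!%:R)).
  rewrite invfM mulrA [X in _ <= X]mulrC ler_wpM2l// ?divr_ge0//.
  by rewrite lef_pV2.
- exact/is_cvg_seriesZ/is_cvg_series_exp_coeff.
Qed.

Lemma Hoo_cvg (R : realType) (z : R) :
  cvgn (series (fun k => (- z) ^+ k / k`!%:R ^+ 2)).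
Proof.
apply: normed_cvg; apply: (@series_le_cvg _ _ (exp_coeff `|z|)).
- by move=> k /=.
- by move=> k; rewrite divr_ge0.
- move=> k; rewrite /= normrM normfV !normrX normrN normr_nat ler_wpM2l//.
  by rewrite lef_pV2 ?posrE ?exprn_gt0 ?ltr0n ?fact_gt0// expr2 ler_peMl// ler1n fact_gt0.
- exact: is_cvg_series_exp_coeff.
Qed.

Definition smallest_positive_zero (R : realType) (F : R -> R) (h : R) : Prop :=
  [/\ 0 < h, F h = 0 & forall z, 0 < z -> F z = 0 -> h <= z].

(* Main.v *)
Require Import Defs.
From HB Require Import structures.
From mathcomp Require Import all_boot all_order all_algebra.
From mathcomp Require Import all_classical all_reals all_analysis.
From mathcomp Require Import measurable_realfun.
From mathcomp Require Import ring lra.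

Set Implicit Arguments.
Unset Strict Implicit.
Unset Printing Implicit Defensive.
Import Order.TTheory GRing.Theory Num.Theory.
Import numFieldNormedType.Exports.
Local Open Scope classical_set_scope.
Local Open Scope ring_scope.

(** Why the theorem holds.

    Put q = a / (1 + a) and let G_q(z) be the sum of the
    (-z)^k / (k! q (q + 1) ... (q + k - 1)), the Bessel-Clifford function
    0F1(; q; -z) ([clifford]).  Then H_a = G_q and H_oo = G_1, so the whole
    statement is about the first positive zero c(q) of G_q for 0 < q <= 1.

    Norm of T_a.  With c = c(q), the functions u(y) = G_q(c y^(1/q)) and
    w(x) = x^a G_{q+1}(c x^(1+a)) satisfy T_a u = w and T_a^* w = lam u, where
    lam = a / (c (1 + a)^2): both are instances of the fundamental theorem of
    calculus, through the identities G_q' = - G_{q+1} / q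
    ([is_derive_clifford]) and G_q(z) = G_{q+1}(z) - z G_{q+2}(z) / (q (q + 1))
    ([clifford_contiguous]); the zero of G_q is what makes the boundary term at
    1 vanish.  Since c is the first zero, u and w are positive on ]0, 1[.  A
    positive singular pair of an operator with nonnegative kernel computes its
    norm: Schur's test with weights u and w gives |T_a|^2 <= lam
    ([schur_le]) and u itself attains the bound ([schur_eq]).  No compactness
    or spectral theory is involved; [opnorm_schur] packages this.

    The difference T_0 - T_a has kernel 1[y > x^a], which up to a null set is
    the transpose of the kernel 1[y <= x^(1/a)] of T_{1/a}.  The roles of u and
    w are then exchanged, and |T_a - T_0| = |T_{1/a}| ([opnorm_T_subr_T0]).
    Thus the behaviour of T_a - T_0 at 0 is that of T_a at infinity.

    The zero.  On [0, 2q] the series of G_q and G_{q+1} alternate with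
    decreasing terms after at most one term, so partial sums bound them
    ([clifford_alternating]).  This yields G_{q+1} > 0, hence G_q decreasing,
    and G_q(2q) <= 0: there is a unique zero in ]0, 2q].  The same bounds give
    the decimals of c(1), and c(q) / q = 1 + q / 2 + O(q^2)
    ([first_zero_expansion]), whence |T_a| = 1 - 3 a / 4 + O(a^2).  For the
    limit q -> 1, |G_q - G_1| is bounded on [0, w] by
    G_1(- w / q) - G_1(- w), which is continuous in q, while |G_1'| >= 1/4 on
    [0, 2]; so c(q) -> c(1) ([first_zero_cvg1]). *)

(** * The Bessel-Clifford series *)

Section clifford.
Context {R : realType}.
Implicit Types (q z : R) (k m n : nat).

Definition rising q k : R := \prod_(0 <= j < k) (q + j%:R).

Lemma rising0 q : rising q 0 = 1.
Proof. by rewrite /rising big_geq. Qed.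

Lemma risingSr q k : rising q k.+1 = rising q k * (q + k%:R).
Proof. by rewrite /rising big_nat_recr. Qed.

Lemma risingSl q k : rising q k.+1 = q * rising (q + 1) k.
Proof.
rewrite /rising big_nat_recl//= addr0; congr (_ * _).
by apply: eq_bigr => i _; rewrite -natr1 addrAC addrA.
Qed.

Lemma rising_gt0 q k : 0 < q -> 0 < rising q k.
Proof. by move=> q0; apply: prodr_gt0 => j _; rewrite ltr_wpDr. Qed.

Lemma rising_1 k : rising 1 k = k`!%:R.
Proof.
elim: k => [|k IH]; first by rewrite rising0.
by rewrite risingSr IH factS natrM mulrC nat1r.
Qed.

Definition clifford_coeff q k : R := (-1) ^+ k / (k`!%:R * rising q k).

Definition clifford q z : R := limn (pseries (clifford_coeff q) z).

Lemma rising_ge_min q k : 0 < q -> Num.min 1 q <= rising q k.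
Proof.
move=> q0; case: k => [|k]; first by rewrite rising0 ge_min lexx.
rewrite risingSl; apply: (@le_trans _ _ q); first by rewrite ge_min lexx orbT.
rewrite ler_peMr ?(ltW q0)//; elim: k => [|k IH]; first by rewrite rising0.
rewrite risingSr; apply: (le_trans IH).
rewrite ler_peMr ?(le_trans _ IH)// -addrA [leRHS]addrC -addrA lerDl.
by rewrite addr_ge0// ltW.
Qed.

Lemma cvg_pseries_clifford q z : 0 < q -> cvgn (pseries (clifford_coeff q) z).
Proof.
move=> q0; have m0 : 0 < Num.min 1 q by rewrite lt_min ltr01.
apply: normed_cvg.
apply: (@series_le_cvg _ _ ((Num.min 1 q)^-1 *: exp_coeff `|z|)).
- by move=> k /=.
- by move=> k; rewrite /= mulr_ge0 ?invr_ge0 ?(ltW m0)// divr_ge0.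
- move=> k; have r0 := rising_gt0 k q0.
  rewrite /clifford_coeff /= !normrM normfV !normrX normrN normr1 expr1n mul1r.
  rewrite normrM normr_nat gtr0_norm// invfM [X in _ <= X](_ : _ =
    (Num.min 1 q)^-1 * (`|z| ^+ k / k`!%:R))//.
  rewrite mulrAC [leLHS]mulrC [_^-1 * `|z| ^+ k]mulrC.
  by rewrite ler_wpM2r ?divr_ge0// lef_pV2// rising_ge_min.
- exact/is_cvg_seriesZ/is_cvg_series_exp_coeff.
Qed.

Lemma clifford_diffs q : 0 < q ->
  pseries_diffs (clifford_coeff q) = - (q^-1) *: clifford_coeff (q + 1).
Proof.
move=> q0; apply/funext => k.
rewrite /pseries_diffs /clifford_coeff /= risingSl factS natrM exprS.
rewrite [RHS](_ : _ = - q^-1 * ((-1) ^+ k / (k`!%:R * rising (q + 1) k)))//.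
have r0 : rising (q + 1) k != 0 by rewrite gt_eqF// rising_gt0// addr_gt0.
have k0 : k`!%:R != 0 :> R by rewrite pnatr_eq0 -lt0n fact_gt0.
have k1 : k.+1%:R != 0 :> R by rewrite pnatr_eq0.
have q0' := lt0r_neq0 q0.
move: r0 k0 k1; move: (rising _ _) (k`!%:R) (k.+1%:R) => r f s r0 f0 s0.
by field; rewrite r0 f0 s0 q0'.
Qed.

Lemma pseriesZ (f : R^nat) (c x : R) : pseries (c *: f) x = c *: pseries f x.
Proof.
apply/funext => n; rewrite [RHS](_ : _ = c * pseries f x n)//.
rewrite /pseries /series/= mulr_sumr.
by apply: eq_bigr => i _; rewrite [RHS]mulrA.
Qed.

(** Differentiating term by term shifts the parameter by one; this is why only
    the functions [clifford (q + n)] occur below. *)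
Lemma is_derive_clifford q z : 0 < q ->
  is_derive z 1 (clifford q) (- q^-1 * clifford (q + 1) z).
Proof.
move=> q0; have q1 : 0 < q + 1 by rewrite addr_gt0.
have -> : - q^-1 * clifford (q + 1) z =
    limn (pseries (pseries_diffs (clifford_coeff q)) z).
  rewrite clifford_diffs// pseriesZ.
  by rewrite limZl_tmp//; exact: cvg_pseries_clifford.
apply: (@pseries_snd_diffs _ _ (`|z| + 1)).
- exact: cvg_pseries_clifford.
- rewrite clifford_diffs// pseriesZ; apply: is_cvgZl_tmp.
  exact: cvg_pseries_clifford.
- have -> : pseries_diffs (pseries_diffs (clifford_coeff q)) =
      (- q^-1) *: pseries_diffs (clifford_coeff (q + 1)).
    rewrite clifford_diffs//; apply/funext => k; rewrite /pseries_diffs.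
    by rewrite /= [LHS]mulrCA.
  rewrite pseriesZ; apply: is_cvgZl_tmp.
  rewrite clifford_diffs// pseriesZ; apply: is_cvgZl_tmp.
  by apply: cvg_pseries_clifford; rewrite addr_gt0.
- by rewrite [ltRHS]ger0_norm ?addr_ge0// ltrDl.
Qed.

Lemma clifford_continuous q : 0 < q -> continuous (clifford q).
Proof.
move=> q0 z; apply/differentiable_continuous/derivable1_diffP.
by have [] := is_derive_clifford z q0.
Qed.

Lemma clifford_at0 q : clifford q 0 = 1.
Proof.
apply: cvg_lim => //; rewrite -(cvg_shiftn 1)/=.
apply: (@cvg_trans _ ((1 : R) @[n --> \oo])); last exact: cvg_cst.
apply: near_eq_cvg; near=> n; rewrite addn1 /pseries/series/= big_nat_recl//=.
rewrite /clifford_coeff rising0 fact0 mulr1 divr1 mulr1 big1 ?addr0//.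
by move=> i _; rewrite expr0n/= mulr0.
Unshelve. all: by end_near. Qed.

(** Combined with [is_derive_clifford] this is the differential equation
    z G'' + q G' + G = 0 of G = [clifford q]; it holds coefficientwise. *)
Lemma clifford_contiguous q z : 0 < q ->
  clifford q z = clifford (q + 1) z - z / (q * (q + 1)) * clifford (q + 2) z.
Proof.
move=> q0; have q1 : 0 < q + 1 by rewrite addr_gt0.
have q2 : 0 < q + 2 by rewrite addr_gt0.
apply: cvg_lim => //; rewrite -cvg_shiftS.
have cv (p : R) : 0 < p -> pseries (clifford_coeff p) z n @[n --> \oo] --> clifford p z.
  exact: cvg_pseries_clifford.
have -> : (fun n => pseries (clifford_coeff q) z n.+1) = (fun n =>
    pseries (clifford_coeff (q + 1)) z n.+1 -
    z / (q * (q + 1)) * pseries (clifford_coeff (q + 2)) z n).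
  apply/funext => n; rewrite /pseries /series/= !big_nat_recl//=.
  rewrite /clifford_coeff !rising0 -addrA; congr (_ + _).
  rewrite mulr_sumr -sumrB; apply: eq_bigr => i _.
  rewrite -/(rising q i.+1) -/(rising (q + 1) i.+1).
  (* express every rising factorial through the one of q + 2 *)
  have e1 : rising (q + 1) i * (q + 1 + i%:R) = (q + 1) * rising (q + 2) i.
    by rewrite -risingSr risingSl -addrA.
  have r2 := rising_gt0 i q2; have r1 := rising_gt0 i q1.
  rewrite (risingSl (q + 1)) risingSl -[q + 1 + 1]addrA.
  have qi : 0 < q + 1 + i%:R by rewrite ltr_wpDr.
  have -> : rising (q + 1) i = (q + 1) * rising (q + 2) i / (q + 1 + i%:R).
    by rewrite -e1 mulfK// gt_eqF.
  have f0 : i`!%:R != 0 :> R by rewrite pnatr_eq0 -lt0n fact_gt0.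
  have i0 : i%:R + 1 != 0 :> R by rewrite natr1 pnatr_eq0.
  rewrite factS natrM !exprS -natr1.
  move: r2 qi f0 i0; rewrite -![1 + 1]/2.
  move: (rising _ _) (i`!%:R) (i%:R) => r f j r0 qj f0 j0.
  by field; rewrite f0 j0 !gt_eqF.
apply: cvgB; first by rewrite (cvg_shiftS (pseries (clifford_coeff (q + 1)) z)); exact: cv.
by apply: cvgMl_tmp; exact: cv.
Qed.

(** Leibniz: peeling off the first term leaves minus a sum of the same kind. *)
Lemma alternating_sum_bounds (t : R^nat) n :
  (forall k, 0 <= t k) -> (forall k, t k.+1 <= t k) ->
  0 <= \sum_(0 <= k < n) (-1) ^+ k * t k <= t 0%N.
Proof.
elim: n t => [|n IH] t t0 td; first by rewrite big_geq// lexx t0.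
rewrite big_nat_recl//= expr0 mul1r.
have /andP[s0 s1] := IH (fun k => t k.+1) (fun k => t0 k.+1) (fun k => td k.+1).
under eq_bigr do rewrite exprS mulN1r mulNr.
rewrite sumrN subr_ge0 gerBl s0 andbT.
exact: le_trans s1 (td 0%N).
Qed.

(** The bound on [z] says that the absolute values of the terms decrease from
    rank [m] on, so the remainder has the sign of its first term and is dominated
    by it. *)
Lemma clifford_alternating q z m : 0 < q -> 0 <= z ->
  z <= m.+1%:R * (q + m%:R) ->
  0 <= (-1) ^+ m * (clifford q z - pseries (clifford_coeff q) z m)
    <= z ^+ m / (m`!%:R * rising q m).
Proof.
move=> q0 z0 zm.
pose t k := z ^+ k / (k`!%:R * rising q k).
have ps n : pseries (clifford_coeff q) z n = \sum_(0 <= k < n) (-1) ^+ k * t k.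
  apply: eq_bigr => i _; rewrite /clifford_coeff /t /=.
  by rewrite mulrAC -mulrA.
have fr k : 0 < k`!%:R * rising q k.
  by rewrite mulr_gt0 ?rising_gt0// ltr0n fact_gt0.
have t0 k : 0 <= t k by rewrite divr_ge0 ?exprn_ge0// ltW.
have td k : t (m + k.+1)%N <= t (m + k)%N.
  rewrite addnS /t; move: (m + k)%N (leq_addr k m) => n mn.
  rewrite exprS factS natrM risingSr.
  have -> : z * z ^+ n / (n.+1%:R * n`!%:R * (rising q n * (q + n%:R))) =
     (z / (n.+1%:R * (q + n%:R))) * (z ^+ n / (n`!%:R * rising q n)).
    rewrite mulf_div; congr (_ / _); rewrite -!mulrA; congr (_ * _).
    by rewrite [RHS]mulrCA; congr (_ * _); rewrite mulrC.
  have qn : 0 < n.+1%:R * (q + n%:R) by rewrite mulr_gt0// ltr_wpDr.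
  rewrite ler_piMl ?divr_ge0 ?exprn_ge0// ?(ltW (fr _))//.
  rewrite ler_pdivrMr// mul1r (le_trans zm)// ler_pM//.
  - by rewrite addr_ge0// ltW.
  - by rewrite ler_nat.
  - by rewrite lerD2l ler_nat.
have B n : 0 <= (-1) ^+ m * (pseries (clifford_coeff q) z (n + m)%N -
    pseries (clifford_coeff q) z m) <= t m.
  have := alternating_sum_bounds n (fun k => t0 (m + k)%N) td.
  rewrite addn0 !ps.
  suff -> : (-1) ^+ m * (\sum_(0 <= k < n + m) (-1) ^+ k * t k -
      \sum_(0 <= k < m) (-1) ^+ k * t k) =
    \sum_(0 <= k < n) (-1) ^+ k * t (m + k)%N by [].
  rewrite [X in _ * (X - _)](@big_cat_nat _ _ _ m)//=; last exact: leq_addl.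
  rewrite addrAC subrr add0r -[X in \sum_(X <= _ < _) _]add0n big_addn addnK.
  rewrite mulr_sumr.
  apply: eq_bigr => i _; rewrite [(m + i)%N]addnC mulrA -exprD addnCA addnn.
  by rewrite exprD -muln2 exprM sqrr_sign mulr1.
have cv : (-1) ^+ m * (pseries (clifford_coeff q) z n -
    pseries (clifford_coeff q) z m) @[n --> \oo] -->
    (-1) ^+ m * (clifford q z - pseries (clifford_coeff q) z m).
  apply: cvgMl_tmp; apply: cvgB; last exact: cvg_cst.
  exact: cvg_pseries_clifford.
apply/andP; split.
  apply: (cvgr_to_ge cv); exists m => // n /= mn.
  by have /andP[] := B (n - m)%N; rewrite subnK.
apply: (cvgr_to_le cv); exists m => // n /= mn.
by have /andP[] := B (n - m)%N; rewrite subnK.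
Qed.

Lemma H_clifford (a : R) : 0 < a -> H a = clifford (a / (1 + a)).
Proof.
move=> a0; apply/funext => z; rewrite /H /clifford /pseries; congr (limn (series _)).
apply/funext => k; rewrite /clifford_coeff exprNn mulrAC; congr (_ / (_ * _) * _).
rewrite /rising (big_addn 0 _ 1) subn1 /=; apply: eq_bigr => i _.
(* the factors match: i + 1 - 1 / (1 + a) = a / (1 + a) + i *)
rewrite natrD; have a1 : 1 + a != 0 by rewrite gt_eqF// addr_gt0.
by field.
Qed.

Lemma Hoo_clifford : @Hoo R = clifford 1.
Proof.
apply/funext => z; rewrite /Hoo /clifford /pseries; congr (limn (series _)).
apply/funext => k; rewrite /clifford_coeff exprNn mulrAC /= rising_1.
by congr (_ / _ * _).
Qed.

(** * The first positive zero *)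

Lemma clifford_le1 q z : 0 < q -> 0 <= z -> z <= 2 * (q + 1) -> clifford q z <= 1.
Proof.
move=> q0 z0 zq; have /andP[+ _] := clifford_alternating (m := 1) q0 z0 zq.
rewrite /pseries/series/= big_nat1 /clifford_coeff rising0 fact0 expr1.
by rewrite mulr1 divr1 mulr1 mulN1r oppr_ge0 subr_le0.
Qed.

Lemma clifford_bounds2 q z : 0 < q -> 0 <= z -> z <= 3 * (q + 2) ->
  1 - z / q <= clifford q z <= 1 - z / q + z ^+ 2 / (2 * (q * (q + 1))).
Proof.
move=> q0 z0 zq; have := clifford_alternating (m := 2) q0 z0 zq.
rewrite /pseries/series/= !big_nat_recr//= big_geq// /clifford_coeff.
rewrite !risingSr rising0 !factS fact0 sqrrN !expr1n mul1r.
move=> H; rewrite -lerBlDl -[X in X && _]subr_ge0; move: H.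
by congr (_ && _); congr (_ <= _); field; rewrite ?gt_eqF ?addr_gt0.
Qed.

Lemma clifford_ge3 q z : 0 < q -> 0 <= z -> z <= 4 * (q + 3) ->
  1 - z / q + z ^+ 2 / (2 * (q * (q + 1)))
    - z ^+ 3 / (6 * (q * (q + 1) * (q + 2))) <= clifford q z.
Proof.
move=> q0 z0 zq; have := clifford_alternating (m := 3) q0 z0 zq.
rewrite /pseries/series/= !big_nat_recr//= big_geq// /clifford_coeff.
rewrite !risingSr rising0 !factS fact0 => /andP[_ H].
rewrite -subr_ge0; move: H; rewrite -subr_ge0.
by congr (_ <= _); field; rewrite ?gt_eqF ?addr_gt0.
Qed.

(** Group the partial sum of order 4 in pairs: on [0, 2q] the first pair is
    nonnegative because q <= 1 and the second one is positive. *)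
Lemma clifford_succ_gt0 q z : 0 < q <= 1 -> 0 <= z <= 2 * q -> 0 < clifford (q + 1) z.
Proof.
move=> /andP[q0 q1] /andP[z0 zq]; have [->|zn0] := eqVneq z 0.
  by rewrite clifford_at0.
have {zn0}z0 : 0 < z by rewrite lt_neqAle eq_sym zn0.
have Q1 : 0 < q + 1 by lra.
have Q2 : 0 < q + 2 by lra.
have Q3 : 0 < q + 3 by lra.
apply: lt_le_trans (clifford_ge3 Q1 (ltW z0) _); last by lra.
rewrite (_ : q + 1 + 1 = q + 2); last by ring.
rewrite (_ : q + 1 + 2 = q + 3); last by ring.
have -> : 1 - z / (q + 1) + z ^+ 2 / (2 * ((q + 1) * (q + 2))) -
   z ^+ 3 / (6 * ((q + 1) * (q + 2) * (q + 3))) =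
   ((q + 1) - z) / (q + 1) +
   z ^+ 2 * (3 * (q + 3) - z) / (6 * ((q + 1) * (q + 2) * (q + 3))).
  by field; rewrite !gt_eqF.
apply: ltr_wpDl; first by rewrite divr_ge0//; lra.
by rewrite divr_gt0 ?mulr_gt0 ?exprn_gt0//; lra.
Qed.

(** This bounds the slope of [clifford 1] away from 0 on an interval that
    contains every [first_zero q]. *)
Lemma clifford_2_ge z : 0 <= z <= 2 -> 1 / 4 <= clifford 2 z.
Proof.
move=> /andP[z0 z2]; apply: le_trans (clifford_ge3 _ z0 _); [|by lra|by lra].
have -> : 1 - z / 2 + z ^+ 2 / (2 * (2 * (2 + 1))) -
    z ^+ 3 / (6 * (2 * (2 + 1) * (2 + 2))) =
    1 - z / 2 + z ^+ 2 / 12 - z ^+ 3 / 144.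
  by field.
nra.
Qed.

Lemma clifford_decr q : 0 < q <= 1 ->
  {in `[0, 2 * q] &, {homo clifford q : x y /~ x < y}}.
Proof.
move=> q01; have /andP[q0 q1] := q01.
apply: ltr0_derive1_lt_cc.
- by move=> x _; have [] := is_derive_clifford x q0.
- move=> x; rewrite in_itv/= => /andP[x0 x2].
  have := is_derive_clifford x q0 => /@derive_val; rewrite derive1E => ->.
  by rewrite mulNr oppr_lt0 mulr_gt0 ?invr_gt0// clifford_succ_gt0// !ltW.
- by apply: continuous_subspaceT => x; exact: clifford_continuous.
Qed.

Lemma clifford_zero_ex q : 0 < q <= 1 ->
  exists c, smallest_positive_zero (clifford q) c /\ c <= 2 * q.
Proof.
move=> q01; have /andP[q0 q1] := q01.
have q20 : 0 <= 2 * q by rewrite mulr_ge0// ltW.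
have G2 : clifford q (2 * q) <= 0.
  (* 2q is chosen so that the partial sum of order 3 is (q - 1) / (q + 1) *)
  have /andP[_ /le_trans] := clifford_bounds2 q0 q20 ltac:(lra); apply.
  rewrite (_ : _ + _ = (q - 1) / (q + 1)); last by field; rewrite !gt_eqF//; lra.
  by rewrite pmulr_lle0 ?invr_gt0; lra.
have [|c] := @IVT R (clifford q) 0 (2 * q) 0 q20
  (continuous_subspaceT (clifford_continuous q0)).
  by rewrite clifford_at0 ge_min G2 orbT le_max ler01.
rewrite in_itv/= => /andP[c0 c2] Gc; exists c; split => //; split => //.
  by rewrite lt_neqAle c0 andbT; apply: contra_eq_neq Gc => <-;
    rewrite clifford_at0 oner_neq0.
move=> z z0 Gz; rewrite leNgt; apply/negP => zc.
have := clifford_decr q01 _ _ zc; rewrite !in_itv/= Gz Gc ltxx => H.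
by suff : false by []; apply: H; lra.
Qed.

Definition first_zero q : R := get [set c | smallest_positive_zero (clifford q) c].

Lemma first_zeroP q : 0 < q <= 1 -> smallest_positive_zero (clifford q) (first_zero q).
Proof.
move=> /clifford_zero_ex[c [cP _]].
exact: (@getPex _ [set c | smallest_positive_zero (clifford q) c]) (ex_intro _ c cP).
Qed.

Lemma first_zero_le q : 0 < q <= 1 -> first_zero q <= 2 * q.
Proof.
move=> q01; have [c [[c0 Gc _] c2]] := clifford_zero_ex q01.
by have [_ _ /(_ _ c0 Gc)/le_trans] := first_zeroP q01; apply.
Qed.

Lemma first_zero_gt0 q : 0 < q <= 1 -> 0 < first_zero q.
Proof. by case/first_zeroP. Qed.

Lemma clifford_first_zero q : 0 < q <= 1 -> clifford q (first_zero q) = 0.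
Proof. by case/first_zeroP. Qed.

Lemma clifford_gt0 q z : 0 < q <= 1 -> 0 <= z < first_zero q -> 0 < clifford q z.
Proof.
move=> q01 /andP[z0 zc]; have c2 := first_zero_le q01.
have := clifford_decr q01 _ _ zc; rewrite !in_itv/= clifford_first_zero//; apply; lra.
Qed.

(** At the two bounds [clifford 1] is about 2 10^-7 and -2 10^-7, while the term of
    rank 8 of its series is about 10^-8 there: partial sums of order 8 and 9, which
    bound it from below and from above, decide the signs. *)
Lemma first_zero_1_bounds :
  1445 / 10 ^+ 3 + 796 / 10 ^+ 6 <= first_zero (1 : R)
    < 1445 / 10 ^+ 3 + 797 / 10 ^+ 6.
Proof.
have q01 : 0 < (1 : R) <= 1 by rewrite ltr01 lexx.
have c2 := first_zero_le q01; have c0 := first_zero_gt0 q01.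
have p8 z : pseries (clifford_coeff 1) z 8 = 1 - z + z ^+ 2 / 4 - z ^+ 3 / 36
    + z ^+ 4 / 576 - z ^+ 5 / (120 * 120) + z ^+ 6 / (720 * 720)
    - z ^+ 7 / (5040 * 5040).
  rewrite /pseries /series/= !big_nat_recr//= big_geq// /clifford_coeff.
  by rewrite !rising_1 !factS fact0; field.
have p9 z : pseries (clifford_coeff 1) z 9 = pseries (clifford_coeff 1) z 8
    + z ^+ 8 / (5040 * 8 * (5040 * 8)).
  rewrite /pseries /series/= big_nat_recr//= /clifford_coeff.
  rewrite !rising_1 !factS fact0; congr (_ + _).
  by field.
have lower z : 0 <= z <= 2 -> 0 < pseries (clifford_coeff 1) z 8 ->
    z <= first_zero 1.
  move=> /andP[z0 z2] S8; rewrite leNgt; apply/negP => cz.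
  have := clifford_alternating (m := 8) ltr01 z0 ltac:(clear - z2; lra).
  rewrite -signr_odd mul1r => /andP[+ _]; rewrite subr_ge0 => /(lt_le_trans S8).
  rewrite ltNge -(clifford_first_zero q01) ltW// (clifford_decr q01)// in_itv/=.
    by rewrite z0 mulr1.
  by rewrite (ltW c0).
have upper z : 0 <= z <= 2 -> pseries (clifford_coeff 1) z 9 < 0 ->
    first_zero 1 < z.
  move=> /andP[z0 z2] S9; rewrite ltNge; apply/negP => cz.
  have := clifford_alternating (m := 9) ltr01 z0 ltac:(clear - z2; lra).
  rewrite -signr_odd expr1 mulN1r oppr_ge0 subr_le0 => /andP[/le_lt_trans/(_ S9) + _].
  rewrite ltNge -(clifford_first_zero q01).
  move: cz; rewrite le_eqVlt => /predU1P[->|cz]; first by rewrite lexx.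
  rewrite ltW// (clifford_decr q01)// in_itv/=.
    by rewrite (ltW c0).
  by rewrite z0 mulr1.
clear q01 c0 c2; apply/andP; split.
  by apply: lower; [apply/andP; split|rewrite p8]; clear; lra.
by apply: upper; [apply/andP; split|rewrite p9 p8]; clear; lra.
Qed.

(** With s = c / q the equation G_q(c) = 0 reads
    s = 1 + s^2 q / (2 (q + 1)) - r, where 0 <= r <= s^3 q^2 / 12.  As s <= 2, a
    first use gives s - 1 = O(q), and a second one the expansion. *)
Lemma first_zero_expansion q : 0 < q <= 1 ->
  `|first_zero q / q - (1 + q / 2)| <= 3 * q ^+ 2.
Proof.
move=> q01; have /andP[q0 q1] := q01.
have c0 := first_zero_gt0 q01; have c2 := first_zero_le q01.
set c := first_zero q in c0 c2 *.
have Gc : clifford q c = 0 by exact: clifford_first_zero.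
have := clifford_bounds2 q0 (ltW c0) ltac:(lra).
have := clifford_ge3 q0 (ltW c0) ltac:(lra); rewrite Gc.
have -> : c = (c / q) * q by rewrite divfK// gt_eqF.
rewrite mulfK ?gt_eqF//; set s := c / q.
have s2 : s <= 2 by rewrite /s ler_pdivrMr.
have s0 : 0 < s by rewrite divr_gt0.
have -> : (s * q) ^+ 2 / (2 * (q * (q + 1))) = s ^+ 2 * (q / (2 * (q + 1))).
  by field; rewrite !gt_eqF//; lra.
have -> : (s * q) ^+ 3 / (6 * (q * (q + 1) * (q + 2))) =
   s ^+ 3 * (q ^+ 2 / (6 * ((q + 1) * (q + 2)))).
  by field; rewrite !gt_eqF//; lra.
have : 0 <= q ^+ 2 / (6 * ((q + 1) * (q + 2))) <= q ^+ 2 / 12.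
  have D0 : 12 <= 6 * ((q + 1) * (q + 2)) by nra.
  have q20 : 0 <= q ^+ 2 by rewrite exprn_ge0// ltW.
  rewrite divr_ge0//=; last by lra.
  by rewrite ler_wpM2l// lef_pV2// posrE; lra.
have : q / 2 - q ^+ 2 / 2 <= q / (2 * (q + 1)) <= q / 2.
  rewrite ler_pdivlMr; last by lra.
  rewrite ler_pdivrMr; last by lra.
  apply/andP; split; nra.
set A := q / (2 * _); set B := _ / (6 * _) => /andP[A1 A2] /andP[B0 B1].
move=> L /andP[s1 U].
have {}s1 : 1 <= s by lra.
have qq : 0 <= q * (1 - q) by apply: mulr_ge0; lra.
have A0 : 0 <= A by lra.
have q20 : 0 <= q ^+ 2 by rewrite exprn_ge0// ltW.
have sA : s ^+ 2 * A <= 4 * A by rewrite ler_wpM2r//; nra.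
have sq : s - 1 <= 2 * q by lra.
have s2q : s ^+ 2 - 1 <= 6 * q by nra.
have sB : s ^+ 3 * B <= 8 * (q ^+ 2 / 12).
  apply: ler_pM => //; first by rewrite exprn_ge0// ltW.
  by rewrite (_ : 8 = 2 ^+ 3); [rewrite lerXn2r ?nnegrE// ltW|ring].
rewrite ler_norml; apply/andP; split.
  have : A <= s ^+ 2 * A by rewrite ler_peMl// expr_ge1// ltW.
  have : 0 <= q ^+ 2 by rewrite exprn_ge0// ltW.
  by lra.
have : s ^+ 2 * A <= (1 + 6 * q) * (q / 2).
  by apply: ler_pM => //; [rewrite exprn_ge0// ltW|lra].
nra.
Qed.

Lemma rising_between q k : 0 < q <= 1 ->
  q ^+ k * k`!%:R <= rising q k <= k`!%:R.
Proof.
move=> /andP[q0 q1]; elim: k => [|k /andP[L U]].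
  by rewrite expr0 rising0 fact0 mulr1 lexx.
rewrite risingSr exprS factS natrM -natr1.
have qk : 0 <= q + k%:R by rewrite addr_ge0// ltW.
have r0 := rising_gt0 k q0.
apply/andP; split.
  rewrite (_ : _ * _ = q ^+ k * k`!%:R * (q * (k%:R + 1))); last by ring.
  rewrite ler_pM//; first by rewrite mulr_ge0// exprn_ge0// ltW.
    by rewrite mulr_ge0 ?addr_ge0// ltW.
  by rewrite mulrDr mulr1 addrC lerD2l ler_piMl.
by rewrite mulrC ler_pM ?(ltW r0)// addrC lerD2l.
Qed.

(** The comparison is termwise, using [rising_between].  At negative arguments all
    the terms of [clifford 1] are nonnegative, so its values there serve as the
    sums of the absolute values. *)
Lemma clifford_dist1 q z w : 0 < q <= 1 -> 0 <= z <= w ->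
  `|clifford q z - clifford 1 z| <= clifford 1 (- (w / q)) - clifford 1 (- w).
Proof.
move=> q01 /andP[z0 zw]; have /andP[q0 q1] := q01.
have cv (p x : R) : 0 < p -> pseries (clifford_coeff p) x n @[n --> \oo] --> clifford p x.
  exact: cvg_pseries_clifford.
have L : `|pseries (clifford_coeff q) z n - pseries (clifford_coeff 1) z n| @[n --> \oo] -->
    `|clifford q z - clifford 1 z|.
  by apply: cvg_norm; apply: cvgB; exact: cv.
have U : pseries (clifford_coeff 1) (- (w / q)) n -
    pseries (clifford_coeff 1) (- w) n @[n --> \oo] -->
    clifford 1 (- (w / q)) - clifford 1 (- w).
  by apply: cvgB; exact: cv.
apply: (ler_cvg_to L U); apply: nearW => n.
rewrite /pseries /series/= -!sumrB; apply: le_trans (ler_norm_sum _ _ _) _.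
apply: ler_sum => k _; rewrite /clifford_coeff rising_1.
have /andP[rl ru] := rising_between k q01.
have r0 := rising_gt0 k q0.
have f0 : 0 < k`!%:R :> R by rewrite ltr0n fact_gt0.
have qk : 0 < q ^+ k by rewrite exprn_gt0.
have -> : (-1) ^+ k / (k`!%:R * rising q k) * z ^+ k -
    (-1) ^+ k / (k`!%:R * k`!%:R) * z ^+ k =
    (-1) ^+ k * (z ^+ k * k`!%:R^-1 * ((rising q k)^-1 - k`!%:R^-1)).
  by field; rewrite !gt_eqF.
have -> : (-1) ^+ k / (k`!%:R * k`!%:R) * (- (w / q)) ^+ k -
    (-1) ^+ k / (k`!%:R * k`!%:R) * (- w) ^+ k =
    w ^+ k * k`!%:R^-1 * ((q ^+ k * k`!%:R)^-1 - k`!%:R^-1).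
  rewrite (exprNn (w / q)) (exprNn w) expr_div_n.
  move: f0 qk (sqrr_sign R k).
  move: ((-1) ^+ k) (w ^+ k) (q ^+ k) (k`!%:R) => s v p f f0 p0 s2.
  transitivity (s ^+ 2 * (v * f^-1 * ((p * f)^-1 - f^-1))).
    by field; rewrite !gt_eqF.
  by rewrite s2 mul1r.
rewrite normrM normr_sign mul1r ger0_norm; last first.
  by rewrite !mulr_ge0 ?exprn_ge0 ?invr_ge0 ?(ltW f0)// subr_ge0 lef_pV2.
rewrite ler_pM//.
- by rewrite mulr_ge0 ?exprn_ge0// invr_ge0 ltW.
- by rewrite subr_ge0 lef_pV2.
- by rewrite ler_wpM2r ?invr_ge0 ?(ltW f0)// lerXn2r ?nnegrE// (le_trans z0).
- by rewrite lerD2r lef_pV2// posrE mulr_gt0.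
Qed.

(** The value of [clifford 1] at [first_zero q] is the distance between
    [clifford 1] and [clifford q] there; divide it by the slope bound of
    [clifford_2_ge]. *)
Lemma first_zero_dist1 q : 0 < q <= 1 ->
  `|first_zero q - first_zero 1| <= 4 * (clifford 1 (- (2 / q)) - clifford 1 (- 2)).
Proof.
move=> q01; have /andP[q0 q1] := q01.
have c0 := first_zero_gt0 q01; have c2 := first_zero_le q01.
have q11 : 0 < (1 : R) <= 1 by rewrite ltr01 lexx.
have d0 := first_zero_gt0 q11; have d2 := first_zero_le q11.
have M (x y : R) : 0 <= x -> x <= y -> y <= 2 ->
    y - x <= 4 * (clifford 1 x - clifford 1 y).
  move=> x0 xy y2.
  have dG (t : R) : t \in `]x, y[ ->
      is_derive t 1 (clifford 1) (- 1^-1 * clifford (1 + 1) t).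
    by move=> _; exact: is_derive_clifford.
  have [t] := MVT_segment xy dG (continuous_subspaceT (clifford_continuous ltr01)).
  rewrite in_itv/= => /andP[xt ty] E.
  have := clifford_2_ge (z := t) ltac:(lra).
  rewrite -[clifford 1 x - _]opprB E invr1 mulN1r mulNr opprK -[(1 + 1)%R]/(2 : R) => G.
  have : 1 / 4 * (y - x) <= clifford 2 t * (y - x) by rewrite ler_wpM2r// subr_ge0.
  lra.
apply: le_trans (_ : 4 * `|clifford 1 (first_zero q)| <= _); last first.
  have := clifford_dist1 (z := first_zero q) (w := 2) q01 ltac:(lra).
  by rewrite clifford_first_zero// sub0r normrN => D; rewrite ler_wpM2l.
have Gd := clifford_first_zero q11.
have [cd|dc] := leP (first_zero q) (first_zero 1).
  rewrite ler0_norm ?subr_le0// opprB; apply: le_trans (M _ _ _ cd _) _; [lra|lra|].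
  by rewrite Gd subr0 ler_wpM2l// ler_norm.
rewrite gtr0_norm ?subr_gt0//; apply: le_trans (M _ _ _ (ltW dc) _) _; [lra|lra|].
by rewrite Gd sub0r ler_wpM2l// -normrN ler_norm.
Qed.

Lemma cvg_ratio1 : a / (1 + a) @[a --> +oo] --> (1 : R).
Proof.
have V : (1 + a)^-1 @[a --> +oo] --> (0 : R).
  apply/gtr0_cvgV0; first by near=> a; rewrite addr_gt0.
  by apply/cvgryPge => M; near=> a; rewrite ler_wpDl.
have W : 1 - (1 + a)^-1 @[a --> +oo] --> (1 : R).
  by rewrite -[X in _ --> X]subr0; apply: cvgB V; exact: cvg_cst.
apply: cvg_trans W; apply: near_eq_cvg; near=> a.
have a1 : 0 < 1 + a by rewrite addr_gt0.
by rewrite /=; field; rewrite gt_eqF.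
Unshelve. all: by end_near. Qed.

Lemma first_zero_cvg1 : first_zero (a / (1 + a)) @[a --> +oo] --> first_zero (1 : R).
Proof.
pose D (q : R) := 4 * (clifford 1 (- (2 / q)) - clifford 1 (- 2)).
have D0 : D (a / (1 + a)) @[a --> +oo] --> (0 : R).
  have -> : (0 : R) = 4 * (clifford 1 (- (2 / 1)) - clifford 1 (- 2)).
    by rewrite divr1 subrr mulr0.
  apply: cvgMl_tmp; apply: cvgB; last exact: cvg_cst.
  apply: continuous_cvg; first exact: clifford_continuous.
  apply: cvgN; apply: cvgMl_tmp; apply: cvgV; first exact: oner_neq0.
  exact: cvg_ratio1.
apply/cvgrPdist_le => e e0; near=> a.
have a0 : 0 < a by [].
rewrite distrC; apply: le_trans (first_zero_dist1 _) _.
  by rewrite divr_gt0 ?addr_gt0//= ler_pdivrMr ?addr_gt0// mul1r lerDr.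
have : `|0 - D (a / (1 + a))| <= e by near: a; move/cvgrPdist_le: D0; exact.
by rewrite sub0r normrN; apply: le_trans; exact: ler_norm.
Unshelve. all: by end_near. Qed.

End clifford.

(** * Schur's test for an indicator kernel *)

Section schur.
Context {d} {X : measurableType d} {R : realType}.
Variable m : {sigma_finite_measure set X -> \bar R}.
Variables (E : set (X * X)).
Hypothesis mE : measurable E.
Implicit Types (f g : X -> R).

Let K x y : R := \1_E (x, y).

Let K0 x y : 0 <= K x y. Proof. by rewrite /K indicE. Qed.

Let mK : measurable_fun setT (\1_E : X * X -> R).
Proof. exact: measurable_indic. Qed.

Let mKx x : measurable_fun setT (K x).
Proof. by apply: (measurableT_comp mK); exact: measurable_pair1. Qed.

Let mKy y : measurable_fun setT (K ^~ y).
Proof. by apply: (measurableT_comp mK); exact: measurable_pair2. Qed.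

Let mKg g x : measurable_fun setT g ->
  measurable_fun setT (fun y => (\1_E (x, y) * g y)%:E).
Proof.
by move=> mg; apply/measurable_EFinP/(measurable_funM (mKx x) mg).
Qed.

Let mKf f y : measurable_fun setT f ->
  measurable_fun setT (fun x => (\1_E (x, y) * f x)%:E).
Proof.
by move=> mf; apply/measurable_EFinP/(measurable_funM (mKy y) mf).
Qed.

Lemma indic_tonelli f g : measurable_fun setT f -> measurable_fun setT g ->
  (forall x, 0 <= f x) -> (forall x, 0 <= g x) ->
  (\int[m]_x ((f x)%:E * \int[m]_y (\1_E (x, y) * g y)%:E) =
   \int[m]_y ((g y)%:E * \int[m]_x (\1_E (x, y) * f x)%:E))%E.
Proof.
move=> mf mg f0 g0.
pose F (p : X * X) : \bar R := (f p.1 * (\1_E p * g p.2))%:E.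
have mF : measurable_fun setT F.
  apply/measurable_EFinP; apply: measurable_funM.
    exact: measurableT_comp.
  by apply: measurable_funM => //; exact: measurableT_comp.
have F0 p : (0 <= F p)%E by rewrite lee_fin !mulr_ge0// K0.
have := @fubini_tonelli _ _ X X R m m F mF F0.
congr (_ = _); apply: eq_integral => x _.
  rewrite -ge0_integralZl//.
  - exact: mKg.
  - by move=> y _; rewrite lee_fin mulr_ge0// K0.
  - exact: f0.
rewrite -ge0_integralZl//.
- by apply: eq_integral => y _; rewrite /F/= -EFinM mulrCA [f _ * _]mulrC mulrCA.
- exact: mKf.
- by move=> y _; rewrite lee_fin mulr_ge0// K0.
- exact: g0.
Qed.

Variables (u w : X -> R) (lam : R).
Hypotheses (mu : measurable_fun setT u) (mw : measurable_fun setT w).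
Hypotheses (u0 : forall y, 0 <= u y) (w0 : forall x, 0 <= w x).
Hypothesis Egt0 : forall x y, E (x, y) -> 0 < w x /\ 0 < u y.
Hypothesis Ku : forall x, (\int[m]_y (\1_E (x, y) * u y)%:E = (w x)%:E)%E.
Hypothesis Kw : forall y, (\int[m]_x (\1_E (x, y) * w x)%:E = (lam * u y)%:E)%E.
Hypothesis lam0 : 0 <= lam.

Lemma schur_eq : (\int[m]_x (w x ^+ 2)%:E = lam%:E * \int[m]_y (u y ^+ 2)%:E)%E.
Proof.
have := indic_tonelli mw mu w0 u0.
under eq_integral do rewrite Ku -EFinM -expr2.
move=> ->; under eq_integral do rewrite Kw -EFinM mulrCA -expr2 EFinM.
rewrite ge0_integralZl//.
- by apply/measurable_EFinP; exact: measurable_funX.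
- by move=> y _; rewrite lee_fin sqr_ge0.
Qed.

(** Cauchy-Schwarz with weight u bounds (int_E f)^2 by w int_E (f^2 / u);
    integrating in x and exchanging the integrals turns w into lam u, which cancels
    the weight.  Cauchy-Schwarz itself comes from 2 s f <= s^2 u + f^2 / u with the
    optimal s, so that infinite integrals need no separate treatment. *)
Lemma schur_le f g : measurable_fun setT f -> measurable_fun setT g ->
  (forall y, 0 <= f y) -> (forall x, 0 <= g x) ->
  (forall x, (g x)%:E <= \int[m]_y (\1_E (x, y) * f y)%:E)%E ->
  (\int[m]_x (g x ^+ 2)%:E <= lam%:E * \int[m]_y (f y ^+ 2)%:E)%E.
Proof.
move=> mf mg f0 g0 gf.
pose h y := f y ^+ 2 * u y `^ (-1).
have mh : measurable_fun setT h.
  apply: measurable_funM; first exact: measurable_funX.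
  exact: (measurableT_comp (measurable_powR _)).
have h0 y : 0 <= h y by rewrite mulr_ge0 ?sqr_ge0 ?powR_ge0.
have CS x : ((g x ^+ 2)%:E <= (w x)%:E * \int[m]_y (\1_E (x, y) * h y)%:E)%E.
  have young (s : R) : 0 <= s -> ((2 * s * g x)%:E <=
      (s ^+ 2 * w x)%:E + \int[m]_y (\1_E (x, y) * h y)%:E)%E.
    move=> s0; apply: (@le_trans _ _ (\int[m]_y ((2 * s)%:E * (\1_E (x, y) * f y)%:E))%E).
      rewrite ge0_integralZl//.
      - by rewrite EFinM lee_wpmul2l// lee_fin mulr_ge0.
      - exact: mKg.
      - by move=> y _; rewrite lee_fin mulr_ge0// K0.
      - by rewrite lee_fin mulr_ge0.
    rewrite (EFinM (s ^+ 2)) -Ku -ge0_integralZl//; last 3 first.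
    - exact: mKg.
    - by move=> y _; rewrite lee_fin mulr_ge0// K0.
    - by rewrite lee_fin sqr_ge0.
    rewrite -ge0_integralD//; last 4 first.
    - by move=> y _; rewrite lee_fin !mulr_ge0 ?sqr_ge0// K0.
    - by apply: measurable_funeM; exact: mKg.
    - by move=> y _; rewrite lee_fin mulr_ge0// K0.
    - exact: mKg.
    apply: ge0_le_integral => //.
    - by move=> y _; rewrite lee_fin !mulr_ge0// K0.
    - by apply: measurable_funeM; exact: mKg.
    - by apply: emeasurable_funD; [apply: measurable_funeM|]; exact: mKg.
    move=> y _; rewrite -!EFinM -EFinD lee_fin indicE.
    case: (boolP ((x, y) \in E)) => /= [|_]; last first.
      by rewrite !mul0r !mulr0 addr0.
    rewrite inE => /Egt0[_ uy0]; rewrite !mul1r /h powR_inv1//.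
    rewrite -subr_ge0 (_ : _ - _ = (s * u y - f y) ^+ 2 / u y).
      by rewrite divr_ge0 ?sqr_ge0.
    by field; rewrite gt_eqF.
  have [wx|wx] := eqVneq (w x) 0.
    rewrite wx mul0e lee_fin (_ : g x = 0) ?expr0n//.
    apply/eqP; rewrite eq_le g0 andbT -lee_fin (le_trans (gf x))//.
    rewrite integral0_eq// => y _; rewrite indicE.
    case: (boolP ((x, y) \in E)) => [|_]; last by rewrite mul0r.
    by rewrite inE => /Egt0[]; rewrite wx ltxx.
  have {}wx : 0 < w x by rewrite lt_neqAle eq_sym wx w0.
  have J0 : (0 <= \int[m]_y (\1_E (x, y) * h y)%:E)%E.
    by apply: integral_ge0 => y _; rewrite lee_fin mulr_ge0// K0.
  have := young (g x / w x) (divr_ge0 (g0 x) (ltW wx)).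
  case: (\int[m]_y _)%E J0 => [J|_ _|//]; last by rewrite gt0_muley ?lte_fin ?leey.
  rewrite -EFinD -EFinM !lee_fin => J0.
  rewrite -lerBlDl (_ : _ - _ = g x ^+ 2 / w x); last by field; rewrite gt_eqF.
  by rewrite ler_pdivrMr// mulrC.
apply: (@le_trans _ _ (\int[m]_x ((w x)%:E * \int[m]_y (\1_E (x, y) * h y)%:E))%E).
  apply: ge0_le_integral => //.
  - by move=> x _; rewrite lee_fin sqr_ge0.
  - by apply/measurable_EFinP; exact: measurable_funX.
  - apply: emeasurable_funM; first exact/measurable_EFinP.
    apply: (@measurable_fun_fubini_tonelli_F _ _ X X R m (fun p => (\1_E p * h p.2)%:E)).
      apply/measurable_EFinP; apply: measurable_funM => //; exact: measurableT_comp.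
    by move=> p; rewrite lee_fin mulr_ge0// K0.
rewrite indic_tonelli//; under eq_integral do rewrite Kw.
rewrite -ge0_integralZl//; last 2 first.
- by apply/measurable_EFinP; exact: measurable_funX.
- by move=> y _; rewrite lee_fin sqr_ge0.
apply: ge0_le_integral => //.
- by move=> y _; rewrite lee_fin; apply: mulr_ge0 => //; apply: mulr_ge0.
- by apply/measurable_EFinP; apply: (measurable_funM mh); apply: measurable_funM.
- by apply: measurable_funeM; apply/measurable_EFinP; exact: measurable_funX.
move=> y _; rewrite -!EFinM lee_fin mulrCA ler_wpM2l//.
have [->|uy] := eqVneq (u y) 0; first by rewrite mulr0 sqr_ge0.
by rewrite /h powR_inv1// divfK.
Qed.

End schur.

(** * Operator norms on L^2[0, 1] *)

Section operator_norm.
Context {R : realType}.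
Implicit Types (f : L2 R).

Lemma mu01_fin_num_fun : fin_num_fun (mu01 R).
Proof.
move=> A mA; rewrite ge0_fin_numE; last exact: measure_ge0.
apply: (@le_lt_trans _ _ (mu01 R setT)); last by rewrite mu01_setT ltry.
by apply: le_measure => //; rewrite inE.
Qed.

HB.instance Definition _ :=
  @Measure_isFinite.Build _ (measurableTypeR R) R (mu01 R) mu01_fin_num_fun.

Lemma mu01_setC_oo : mu01 R (~` `]0, 1[) = 0%E.
Proof.
apply: (@subset_measure0 _ _ _ (@lebesgue_measure R) _ ([set 0] `|` [set 1])).
- by apply: measurableI => //; exact: measurableC.
- by apply: measurableU.
- move=> x [/= nx]; rewrite !in_itv/= => /andP[x0 x1]; move: nx; rewrite in_itv/= => /negP.
  rewrite negb_and -!leNgt => /orP[h|h].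
    by left; apply/eqP; rewrite eq_le h x0.
  by right; apply/eqP; rewrite eq_le h x1.
- by apply/countable_lebesgue_measure0/finite_set_countable.
Qed.

Lemma mu01_eq_integral (F G : measurableTypeR R -> \bar R) :
  measurable_fun setT F -> measurable_fun setT G ->
  (forall x, 0 < x < 1 -> F x = G x) ->
  (\int[mu01 R]_x F x = \int[mu01 R]_x G x)%E.
Proof.
move=> mF mG FG; apply: ae_eq_integral => //.
exists (~` `]0, 1[); split; [exact: measurableC|exact: mu01_setC_oo|].
move=> x /= nFG; rewrite in_itv/= => x01; apply: nFG => _; exact: FG.
Qed.

Lemma L2norm_sqrt f :
  L2norm f = (Num.sqrt (\int[mu01 R]_x (f x ^+ 2)))%:E.
Proof.
rewrite /L2norm unlock/=.
under eq_integral do rewrite /= powR_mulrn// real_normK ?num_real//.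
rewrite -[X in (X `^ _)%E]fineK; last first.
  apply: (integrable_fin_num measurableT).
  exact: (Lfun2_integrable_sqr (LfunP f)).
rewrite poweR_EFin powR12_sqrt//.
by apply: fine_ge0; apply: integral_ge0 => x _; rewrite lee_fin sqr_ge0.
Qed.

Lemma bounded_L2 (u : measurableTypeR R -> R) : measurable_fun setT u ->
  (forall x, 0 <= u x <= 1) -> u \in Lfun (mu01 R) 2%:E.
Proof.
move=> mu u1; rewrite inE; apply/andP; split; rewrite inE//=.
rewrite /finite_norm unlock; apply: poweR_lty.
apply: (@le_lt_trans _ _ (\int[mu01 R]_x 1%:E)%E).
  apply: ge0_le_integral => //=.
    apply/measurable_EFinP; apply: (@measurableT_comp _ _ _ _ _ _ (@powR R ^~ 2)) => //.
    exact: measurableT_comp.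
  move=> x _; have /andP[x0 x1] := u1 x.
  by rewrite lee_fin powR_mulrn// exprn_ile1// ger0_norm.
by rewrite integral_cst// [X in (_ * X)%E]mu01_setT mule1 ltry.
Qed.

Variables (A : L2 R -> L2 R) (E : set (measurableTypeR R * measurableTypeR R)).
Variables (u w : measurableTypeR R -> R) (lam : R).
Hypothesis mE : measurable E.
Hypothesis AE : forall f x, 0 < x < 1 ->
  `|A f x| = `|\int[mu01 R]_y (\1_E (x, y) * f y)|.
Hypothesis E01 : forall x y, E (x, y) -> 0 < x < 1.
Hypotheses (mu : measurable_fun setT u) (mw : measurable_fun setT w).
Hypotheses (u01 : forall y, 0 <= u y <= 1) (w0 : forall x, 0 <= w x).
Hypothesis u_gt0 : forall y, 0 < y < 1 -> 0 < u y.
Hypothesis Egt0 : forall x y, E (x, y) -> 0 < w x /\ 0 < u y.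
Hypothesis Ku : forall x, (\int[mu01 R]_y (\1_E (x, y) * u y)%:E = (w x)%:E)%E.
Hypothesis Kw : forall y, (\int[mu01 R]_x (\1_E (x, y) * w x)%:E = (lam * u y)%:E)%E.
Hypothesis lam0 : 0 <= lam.

(** The action of A is prescribed up to sign only, because T_a - T_0 has a negative
    kernel.  The bound is [schur_le]; it is attained at u / |u|, where
    [schur_eq] evaluates the norm of w. *)
Lemma opnorm_schur : opnorm A = (Num.sqrt lam)%:E.
Proof.
have u0 y : 0 <= u y by have /andP[] := u01 y.
have mEx x : measurable_fun setT (fun y : measurableTypeR R => \1_E (x, y) : R).
  have mK : measurable_fun setT (\1_E : _ -> R) by exact: measurable_indic.
  by apply: (measurableT_comp mK); exact: measurable_pair1.
have iL f : ((\int[mu01 R]_x (f x ^+ 2))%:E = \int[mu01 R]_x (f x ^+ 2)%:E)%E.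
  rewrite fineK//; apply: (integrable_fin_num measurableT).
  exact: (Lfun2_integrable_sqr (LfunP f)).
have iE f x : (mu01 R).-integrable setT (EFin \o (fun y => \1_E (x, y) * f y)).
  apply: (le_integrable measurableT _ _ (L2_integrable f measurableT)).
    by apply/measurable_EFinP; exact: measurable_funM.
  move=> y _; rewrite lee_fin normrM ler_piMl// indicE ger0_norm//.
  by case: (_ \in _).
have IA0 f : 0 <= \int[mu01 R]_x (f x ^+ 2).
  by apply: fine_ge0; apply: integral_ge0 => x _; rewrite lee_fin sqr_ge0.
pose g f : measurableTypeR R -> R := fun x => \1_(`]0, 1[) x * `|A f x|.
have mg f : measurable_fun setT (g f).
  apply: measurable_funM; first exact: measurable_indic.
  exact: measurableT_comp.
have gE f : (\int[mu01 R]_x (A f x ^+ 2)%:E = \int[mu01 R]_x (g f x ^+ 2)%:E)%E.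
  apply: mu01_eq_integral.
  - by apply/measurable_EFinP; exact: measurable_funX.
  - by apply/measurable_EFinP; exact: measurable_funX.
  - move=> x x01; rewrite /g indicE mem_set ?in_itv//= mul1r.
    by rewrite real_normK ?num_real.
apply/eqP; rewrite eq_le; apply/andP; split.
  apply: ge_ereal_sup => _ [f /= f1 <-].
  rewrite L2norm_sqrt lee_fin ler_wsqrtr//.
  rewrite -lee_fin iL gE.
  apply: le_trans (@schur_le _ (measurableTypeR R) R (mu01 R) E mE u w lam
    mu mw u0 w0 Egt0 Ku Kw lam0 (fun y => `|f y|) (g f) _ (mg f) _ _ _) _.
  - exact: measurableT_comp.
  - by move=> y /=.
  - by move=> x; rewrite /g mulr_ge0// indicE.
  - move=> x; rewrite /g indicE; have [|_] := boolP (x \in _); last first.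
      rewrite mul0r; apply: integral_ge0 => y _.
      by rewrite lee_fin mulr_ge0// indicE.
    rewrite inE/= in_itv/= => x01; rewrite mul1r AE//.
    have := le_normr_Rintegral (mu := mu01 R) measurableT (iE f x).
    rewrite -lee_fin => /le_trans; apply.
    rewrite /Rintegral fineK; last first.
      apply: (integrable_fin_num measurableT).
      exact: (integrable_norm (iE f x)).
    apply: ge0_le_integral => //.
    + by apply/measurable_EFinP/measurableT_comp => //; exact: measurable_funM.
    + by apply/measurable_EFinP; apply: measurable_funM => //; exact: measurableT_comp.
    + by move=> y _; rewrite normrM lee_fin ler_wpM2r// indicE ger0_norm.
  under eq_integral do rewrite real_normK ?num_real//.
  rewrite -iL -EFinM lee_fin ler_piMr//.
  move: f1; rewrite L2norm_sqrt lee_fin => f1.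
  by rewrite -(sqr_sqrtr (IA0 f)) exprn_ile1 ?sqrtr_ge0.
pose U : L2 R := Lfun_Sub (lee1n 2) (bounded_L2 mu u01).
have := schur_eq (m := mu01 R) mE mu mw u0 w0 Ku Kw lam0.
rewrite -(iL U).
set I := \int[mu01 R]_x (U x ^+ 2) => wI.
have I0 : 0 < I.
  rewrite lt_neqAle IA0 andbT eq_sym; apply/eqP => I0.
  have : (\int[mu01 R]_x `|(U x ^+ 2)%:E| = 0)%E.
    by under eq_integral do rewrite gee0_abs ?lee_fin ?sqr_ge0//; rewrite -iL -/I I0.
  move/(ae_eq_integral_abs _ measurableT _).1 => /(_ _)[].
    by apply/measurable_EFinP; exact: measurable_funX.
  move=> N [mN N0 UN].
  have : (mu01 R `]0%R, 1%R[ <= mu01 R N)%E.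
    apply: le_measure; rewrite ?inE// => x /= x01; apply: UN => /= h.
    have [/eqP] := h Logic.I; rewrite sqrf_eq0 => /eqP ux.
    have : 0 < u x by apply: u_gt0; move: x01; rewrite in_itv.
    by rewrite [u x]ux ltxx.
  rewrite N0 /mu01 /mrestr setIidl; last by apply: subset_itvW.
  by rewrite lebesgue_measure_itv/= lte_fin ltr01 oppr0 adde0 lee_fin ler10.
pose c := (Num.sqrt I)^-1.
have c0 : 0 <= c by rewrite invr_ge0 sqrtr_ge0.
have c2 : c ^+ 2 * I = 1 by rewrite exprVn sqr_sqrtr ?(ltW I0)// mulVf// gt_eqF.
pose V : L2 R := c *: U.
apply: ereal_sup_ubound; exists V => /=.
  rewrite L2norm_sqrt lee_fin.
  under eq_Rintegral do rewrite exprMn.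
  rewrite RintegralZl//; last exact: (Lfun2_integrable_sqr (LfunP U)).
  by rewrite c2 sqrtr1.
have gV x : g V x = c * w x.
  rewrite /g indicE; have [|/negP xn] := boolP (x \in _).
    rewrite inE/= in_itv/= => x01; rewrite mul1r AE//.
    under eq_Rintegral do rewrite mulrCA.
    rewrite RintegralZl//; last exact: (iE U).
    rewrite normrM (ger0_norm c0); congr (_ * _).
    by rewrite /Rintegral (Ku x)/= ger0_norm.
  rewrite mul0r; apply/esym/eqP; rewrite mulf_eq0; apply/orP; right.
  suff : (w x)%:E = 0%E by case=> ->.
  rewrite -Ku integral0_eq// => y _; rewrite indicE memNset ?mul0r//.
  by move=> /E01 x01; apply: xn; rewrite inE/= in_itv.
rewrite L2norm_sqrt; congr (Num.sqrt _)%:E.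
apply: (@EFin_inj R); rewrite iL gE.
under eq_integral do rewrite gV exprMn EFinM.
rewrite ge0_integralZl//.
- by rewrite wI -!EFinM mulrCA c2 mulr1.
- by apply/measurable_EFinP; exact: measurable_funX.
- by move=> x _; rewrite lee_fin sqr_ge0.
- by rewrite lee_fin sqr_ge0.
Qed.

End operator_norm.

(** * The singular functions of T_a *)

Section singular_functions.
Context {R : realType}.
Implicit Types (a x y t s : R).

Lemma powR_continuous_gt0 x p : 0 < x -> {for x, continuous (fun t : R => t `^ p)}.
Proof.
move=> x0; apply/differentiable_continuous/derivable1_diffP.
by apply: derivable_powR; rewrite in_itv/= x0.
Qed.

Lemma powR_cvg_right x p : 0 <= x -> 0 < p -> t `^ p @[t --> x^'+] --> x `^ p.
Proof.
rewrite le_eqVlt => /predU1P[<-|x0] p0.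
  by rewrite powR0 ?gt_eqF//; exact: powR_cvg0.
apply: cvg_at_right_filter; exact: powR_continuous_gt0.
Qed.

Variable a : R.
Hypothesis a0 : 0 < a.

Definition clifford_param : R := a / (1 + a).
Definition clifford_root : R := first_zero clifford_param.
(** The squared singular value: the factor lam in T_a^* w = lam u. *)
Definition singular_sq : R := a / (clifford_root * (1 + a) ^+ 2).
Definition right_fun y : R :=
  clifford clifford_param (clifford_root * y `^ clifford_param^-1).
Definition left_fun x : R :=
  x `^ a * clifford (clifford_param + 1) (clifford_root * x `^ (1 + a)).

Lemma clifford_param01 : 0 < clifford_param <= 1.
Proof.
have a1 : 0 < 1 + a by rewrite addr_gt0.
by rewrite /clifford_param divr_gt0//= ler_pdivrMr// mul1r lerDr.
Qed.

Let r0 : 0 < clifford_param. Proof. by case/andP: clifford_param01. Qed.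
Let z0 : 0 < clifford_root. Proof. exact: first_zero_gt0 clifford_param01. Qed.
Let a1 : 0 < 1 + a. Proof. by rewrite addr_gt0. Qed.
Let r10 : 0 < clifford_param + 1. Proof. by rewrite addr_gt0. Qed.

Lemma is_derive_clifford_powR (q c p y : R) : 0 < q -> 0 < y ->
  is_derive y 1 (fun t => clifford q (c * t `^ p))
    (- q^-1 * clifford (q + 1) (c * y `^ p) * (c * (p * y `^ (p - 1)))).
Proof.
move=> q0 y0.
apply: (@is_derive1_comp _ (clifford q) (fun t => c * t `^ p)).
  exact: is_derive_clifford.
have := is_derive1_powR p y0 => H.
exact: is_deriveZ.
Qed.

Lemma clifford_powR_right (q c p x : R) : 0 < q -> 0 <= x -> 0 < p ->
  clifford q (c * t `^ p) @[t --> x^'+] --> clifford q (c * x `^ p).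
Proof.
move=> q0 x0 p0; apply: continuous_cvg; first exact: clifford_continuous.
by apply: cvgMl_tmp; exact: powR_cvg_right.
Qed.

Lemma clifford_powR_continuous (q c p x : R) : 0 < q -> 0 < x ->
  {for x, continuous (fun t => clifford q (c * t `^ p))}.
Proof.
move=> q0 x0; apply: continuous_cvg; first exact: clifford_continuous.
by apply: cvgMl_tmp; exact: powR_continuous_gt0.
Qed.

(** The integrand is the derivative of the right-hand side by
    [clifford_contiguous]: the exponent 1/q matches the factor z of that identity
    with the derivative of the argument. *)
Lemma integral_right_fun t : 0 < t ->
  (\int[lebesgue_measure]_(y in `[0%R, t]) (right_fun y)%:E =
   (t * clifford (clifford_param + 1) (clifford_root * t `^ clifford_param^-1))%:E)%E.
Proof.
move=> t0.
pose F y := y * clifford (clifford_param + 1) (clifford_root * y `^ clifford_param^-1).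
have p0 : 0 < clifford_param^-1 by rewrite invr_gt0.
have dF y : 0 < y -> is_derive y 1 F (right_fun y).
  move=> y0.
  have D : is_derive y 1 F _ :=
    is_deriveM (is_derive_id y 1)
      (is_derive_clifford_powR clifford_root clifford_param^-1 r10 y0).
  apply: is_derive_eq D _.
  rewrite /right_fun (clifford_contiguous _ r0).
  rewrite (_ : clifford_param + 1 + 1 = clifford_param + 2); last by ring.
  set G1 := clifford (clifford_param + 1) _.
  set G2 := clifford (clifford_param + 2) _.
  rewrite -[in RHS](mulr_powRB1 (ltW y0) p0) /GRing.scale/= mulr1.
  by field; rewrite !gt_eqF.
rewrite (@continuous_FTC2 _ right_fun F 0 t t0).
- by rewrite /F mul0r sube0.
- apply/(continuous_within_itvP _ t0); split.
  + move=> y; rewrite in_itv/= => /andP[y0 _].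
    exact: clifford_powR_continuous.
  + exact: clifford_powR_right.
  + by apply: cvg_at_left_filter; exact: clifford_powR_continuous.
- split.
  + by move=> y; rewrite in_itv/= => /andP[y0 _]; have [] := dF y y0.
  + apply: cvgM; last exact: clifford_powR_right.
    by apply: cvg_at_right_filter; exact: cvg_id.
  + apply: cvg_at_left_filter; apply/differentiable_continuous/derivable1_diffP.
    by have [] := dF t t0.
- move=> y; rewrite in_itv/= => /andP[y0 _].
  by rewrite derive1E; have /@derive_val := dF y y0.
Qed.

(** [left_fun] is a multiple of the derivative of G_q(c x^(1 + a)), whose value
    at x = 1 is G_q(c) = 0. *)
Lemma integral_left_fun s : 0 < s < 1 ->
  (\int[lebesgue_measure]_(x in `[s, 1%R]) (left_fun x)%:E =
   (singular_sq * clifford clifford_param (clifford_root * s `^ (1 + a)))%:E)%E.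
Proof.
move=> /andP[s0 s1].
pose F x := - singular_sq * clifford clifford_param (clifford_root * x `^ (1 + a)).
have dF x : 0 < x -> is_derive x 1 F (left_fun x).
  move=> x0.
  have D : is_derive x 1 F _ :=
    is_deriveZ (- singular_sq) (is_derive_clifford_powR clifford_root (1 + a) r0 x0).
  apply: is_derive_eq D _.
  rewrite /left_fun [1 + a - 1]addrAC subrr add0r /GRing.scale/=.
  rewrite /singular_sq; move: (clifford _ _) => G; rewrite /clifford_param.
  by field; rewrite !gt_eqF.
have cF x : 0 < x -> {for x, continuous F}.
  move=> x0; apply/differentiable_continuous/derivable1_diffP.
  by have [] := dF x x0.
have cl x : 0 < x -> {for x, continuous left_fun}.
  move=> x0; apply: cvgM; first exact: powR_continuous_gt0.
  exact: clifford_powR_continuous.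
rewrite (@continuous_FTC2 _ left_fun F s 1 s1).
- rewrite /F powR1 mulr1 clifford_first_zero ?mulr0; last exact: clifford_param01.
  by rewrite -EFinB sub0r mulNr opprK.
- apply/(continuous_within_itvP _ s1); split.
  + by move=> x; rewrite in_itv/= => /andP[sx _]; apply/cl/(lt_trans s0).
  + by apply: cvg_at_right_filter; exact: cl.
  + by apply: cvg_at_left_filter; exact: cl.
- split.
  + move=> x; rewrite in_itv/= => /andP[sx _].
    by have [] := dF x (lt_trans s0 sx).
  + by apply: cvg_at_right_filter; exact: cF.
  + by apply: cvg_at_left_filter; exact: cF.
- move=> x; rewrite in_itv/= => /andP[sx _].
  by rewrite derive1E; have /@derive_val := dF x (lt_trans s0 sx).
Qed.

End singular_functions.

(** * The kernel of T_a *)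

Section kernel.
Context {R : realType}.
Notation mR := (measurableTypeR R).
Implicit Types (x y : R) (f : L2 R).

(** The support of the kernel of T_a, cut down to the open unit square: there the
    singular functions are positive, which [opnorm_schur] requires on the whole
    support. *)
Definition powerT_region (a : R) : set (mR * mR) :=
  [set p | [/\ 0 < p.1 < 1, 0 < p.2 & p.2 <= p.1 `^ a]].

Lemma powerT_region_measurable (a : R) : measurable (powerT_region a).
Proof.
have -> : powerT_region a = (fst @^-1` `]0, 1[) `&` (snd @^-1` `]0, +oo[) `&`
    ((fun p : mR * mR => p.1 `^ a - p.2) @^-1` `[0, +oo[).
  apply/seteqP; split => [[x y]|[x y]]; rewrite /powerT_region/= !in_itv/= !andbT.
    by case=> -> ->; rewrite subr_ge0.
  by case=> -[-> ->]; rewrite subr_ge0.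
apply: measurableI; first apply: measurableI.
- by rewrite -[X in measurable X]setTI; apply: measurable_fst.
- by rewrite -[X in measurable X]setTI; apply: measurable_snd.
- rewrite -[X in measurable X]setTI.
  have : measurable_fun setT (fun p : mR * mR => p.1 `^ a - p.2).
    apply: measurable_funB; last exact: measurable_snd.
    exact: (measurableT_comp (measurable_powR a) measurable_fst).
  exact.
Qed.

Section parameter.
Variable a : R.
Hypothesis a0 : 0 < a.

Lemma powR_lt1 x (p : R) : 0 < p -> 0 <= x < 1 -> x `^ p < 1.
Proof.
move=> p0 /andP[x0 x1].
by have := gt0_ltr_powR p0 x0 ler01 x1; rewrite powR1.
Qed.

Lemma powerT_region_xsection x : 0 < x < 1 ->
  (fun y : mR => \1_(powerT_region a) (x, y) : R) = \1_`]0, x `^ a].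
Proof.
move=> x01; apply/funext => y; rewrite !indicE; congr (nat_of_bool _)%:R.
apply/idP/idP; rewrite !inE/= in_itv/=; first by case=> _ /= -> ->.
by move=> /andP[y0 yx]; split.
Qed.

Lemma powerT_region_ysection y : 0 < y < 1 ->
  (fun x : mR => \1_(powerT_region a) (x, y) : R) = \1_`[y `^ a^-1, 1[.
Proof.
move=> /andP[y0 y1]; apply/funext => x; rewrite !indicE; congr (nat_of_bool _)%:R.
have yx : 0 < x -> (y <= x `^ a) = (y `^ a^-1 <= x).
  have -> : (y <= x `^ a) = ((y `^ a^-1) `^ a <= x `^ a).
    by rewrite -powRrM mulVf ?gt_eqF// powRr1// ltW.
  move=> x0.
  apply/idP/idP => [|h].
    apply: contraLR; rewrite -!ltNge => h.
    by apply: gt0_ltr_powR; rewrite ?nnegrE ?powR_ge0// ltW.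
  by rewrite ge0_ler_powR ?nnegrE ?powR_ge0 ?(ltW a0) ?(ltW x0).
apply/idP/idP; rewrite !inE/= in_itv/=.
  by case=> /= /andP[x0 ->] _; rewrite yx// => ->.
move=> /andP[yx' x1]; have x0 : 0 < x by apply: lt_le_trans yx'; rewrite powR_gt0.
by split; rewrite /= ?x0 ?x1// yx.
Qed.

Lemma powerT_region01 x y : powerT_region a (x, y) -> 0 < x < 1 /\ 0 < y < 1.
Proof.
move=> [/= x01 y0 yx]; split => //; rewrite y0 (le_lt_trans yx)// powR_lt1//.
by have /andP[x0 ->] := x01; rewrite ltW.
Qed.

Lemma powerT_region_out x y : ~ (0 < x < 1 /\ 0 < y < 1) ->
  \1_(powerT_region a) (x, y) = 0 :> R.
Proof.
by move=> n; rewrite indicE memNset//= => /powerT_region01.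
Qed.

Lemma mu01_integral_lebesgue (S : set mR) (F : mR -> \bar R) :
  S `<=` `[0, 1] ->
  (\int[mu01 R]_(y in S) F y = \int[@lebesgue_measure R]_(y in S) F y)%E.
Proof.
move=> S01; apply: eq_measure_integral => B mB BS; congr (lebesgue_measure _).
by apply: setIidl; exact: subset_trans S01.
Qed.

Lemma mu01_integral_indic (S : set mR) (F : mR -> R) : measurable S ->
  S `<=` `[0, 1] ->
  (\int[mu01 R]_y (\1_S y * F y)%:E = \int[@lebesgue_measure R]_(y in S) (F y)%:E)%E.
Proof.
move=> mS S01; apply: etrans (mu01_integral_lebesgue _ S01).
rewrite [RHS]integral_mkcond epatch_indic; apply: eq_integral => y _.
by rewrite /= -EFinM mulrC.
Qed.

(** Cut off outside ]0, 1[, so that the equations required by [opnorm_schur] hold at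
    every real. *)
Definition right_vec (y : mR) : R := \1_`]0, 1[ y * right_fun a y.
Definition left_vec (x : mR) : R := \1_`]0, 1[ x * left_fun a x.

Let r01 : 0 < clifford_param a <= 1. Proof. exact: clifford_param01. Qed.
Let r0 : 0 < clifford_param a. Proof. by case/andP: r01. Qed.
Let r10 : 0 < clifford_param a + 1. Proof. by rewrite addr_gt0. Qed.
Let z0 : 0 < clifford_root a. Proof. exact: first_zero_gt0. Qed.
Let z2 : clifford_root a <= 2 * clifford_param a. Proof. exact: first_zero_le. Qed.

Lemma clifford_powR_measurable (q c p : R) : 0 < q ->
  measurable_fun setT (fun y : mR => clifford q (c * y `^ p)).
Proof.
move=> q0; apply: (@measurableT_comp _ _ _ _ _ _ (clifford q)).
  by apply: continuous_measurable_fun; exact: clifford_continuous.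
by apply: measurable_funM => //; exact: measurable_powR.
Qed.

Lemma right_vec_measurable : measurable_fun setT right_vec.
Proof.
apply: measurable_funM; first exact: measurable_indic.
exact: clifford_powR_measurable.
Qed.

Lemma left_vec_measurable : measurable_fun setT left_vec.
Proof.
apply: measurable_funM; first exact: measurable_indic.
apply: measurable_funM; first exact: measurable_powR.
exact: clifford_powR_measurable.
Qed.

Let arg_lt x (p : R) : 0 < p -> 0 < x < 1 -> 0 <= clifford_root a * x `^ p < clifford_root a.
Proof.
move=> p0 /andP[x0 x1]; rewrite mulr_ge0 ?powR_ge0 ?(ltW z0)//=.
by rewrite gtr_pMr// powR_lt1// ltW.
Qed.

Lemma right_fun_bounds y : 0 < y < 1 -> 0 < right_fun a y <= 1.
Proof.
move=> y01; have p0 : 0 < (clifford_param a)^-1 by rewrite invr_gt0.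
have /andP[t0 t1] := arg_lt p0 y01; rewrite /right_fun clifford_gt0 ?t0//=.
by rewrite clifford_le1//; have := z2; lra.
Qed.

Lemma left_fun_bounds x : 0 < x < 1 -> 0 < left_fun a x <= 1.
Proof.
move=> x01; have p0 : 0 < 1 + a by rewrite addr_gt0.
have /andP[t0 t1] := arg_lt p0 x01.
have xa : x `^ a <= 1 by rewrite ltW// powR_lt1//; case/andP: x01 => /ltW -> ->.
have G0 : 0 < clifford (clifford_param a + 1) (clifford_root a * x `^ (1 + a)).
  by apply: clifford_succ_gt0; rewrite ?r01 ?t0//=; have := z2; lra.
rewrite /left_fun mulr_gt0// ?powR_gt0//=; last by case/andP: x01.
rewrite mulr_ile1 ?powR_ge0 ?(ltW G0)// clifford_le1//; have := z2; lra.
Qed.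

Lemma vec_out x (F : R -> R) : ~ (0 < x < 1) -> \1_`]0, 1[ x * F x = 0.
Proof. by move=> n; rewrite indicE memNset ?mul0r//= in_itv. Qed.

Lemma vec_in x (F : R -> R) : 0 < x < 1 -> \1_`]0, 1[ x * F x = F x.
Proof. by move=> x01; rewrite indicE mem_set ?mul1r//= in_itv. Qed.

Lemma right_vec01 y : 0 <= right_vec y <= 1.
Proof.
have [y01|/negP n] := boolP (0 < y < 1); last by rewrite /right_vec vec_out// lexx ler01.
by rewrite /right_vec vec_in//; have /andP[/ltW -> ->] := right_fun_bounds y01.
Qed.

Lemma left_vec01 x : 0 <= left_vec x <= 1.
Proof.
have [y01|/negP n] := boolP (0 < x < 1); last by rewrite /left_vec vec_out// lexx ler01.
by rewrite /left_vec vec_in//; have /andP[/ltW -> ->] := left_fun_bounds y01.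
Qed.

Lemma powerT_region_gt0 x y : powerT_region a (x, y) -> 0 < left_vec x /\ 0 < right_vec y.
Proof.
move=> /powerT_region01[x01 y01]; rewrite /left_vec /right_vec !vec_in//.
by have /andP[-> _] := left_fun_bounds x01; have /andP[-> _] := right_fun_bounds y01.
Qed.

Lemma integral_right_vec x :
  (\int[mu01 R]_y (\1_(powerT_region a) (x, y) * right_vec y)%:E = (left_vec x)%:E)%E.
Proof.
have [x01|/negP n] := boolP (0 < x < 1); last first.
  rewrite /left_vec vec_out// integral0_eq// => y _.
  by rewrite powerT_region_out ?mul0r// => -[].
have /andP[x0 x1] := x01.
have xa0 : 0 < x `^ a by rewrite powR_gt0.
have xa1 : x `^ a < 1 by rewrite powR_lt1// ltW.
under eq_integral do rewrite (congr1 (@^~ _) (powerT_region_xsection x01)).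
rewrite mu01_integral_indic//; last first.
  by move=> y /=; rewrite !in_itv/= => /andP[/ltW -> /le_trans -> //]; exact: ltW.
transitivity (\int[@lebesgue_measure R]_(y in `]0%R, (x `^ a)%R]) (right_fun a y)%:E)%E.
  apply: eq_integral => y; rewrite inE/= in_itv/= => /andP[y0 yx].
  by rewrite /right_vec vec_in// y0 (le_lt_trans yx).
rewrite integral_itv_obnd_cbnd; last first.
  apply/measurable_EFinP/measurable_funTS.
  exact: clifford_powR_measurable.
rewrite (integral_right_fun a0 xa0) /left_vec (vec_in _ x01) /left_fun -powRrM.
rewrite (_ : a * (clifford_param a)^-1 = 1 + a)//.
by rewrite /clifford_param invf_div mulrC divfK ?gt_eqF.
Qed.

Lemma integral_left_vec y :
  (\int[mu01 R]_x (\1_(powerT_region a) (x, y) * left_vec x)%:E =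
   (singular_sq a * right_vec y)%:E)%E.
Proof.
have [y01|/negP n] := boolP (0 < y < 1); last first.
  rewrite /right_vec vec_out// mulr0 integral0_eq// => x _.
  by rewrite powerT_region_out ?mul0r// => -[].
have /andP[y0 y1] := y01; have ai0 : 0 < a^-1 by rewrite invr_gt0.
have ya0 : 0 < y `^ a^-1 by rewrite powR_gt0.
have ya1 : y `^ a^-1 < 1 by rewrite powR_lt1// ltW.
under eq_integral do rewrite (congr1 (@^~ _) (powerT_region_ysection y01)).
rewrite mu01_integral_indic//; last first.
  move=> x /=; rewrite !in_itv/= => /andP[/(lt_le_trans ya0)/ltW -> /ltW -> //].
transitivity (\int[@lebesgue_measure R]_(x in `[(y `^ a^-1)%R, 1%R[) (left_fun a x)%:E)%E.
  apply: eq_integral => x; rewrite inE/= in_itv/= => /andP[yx x1].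
  by rewrite /left_vec vec_in// x1 (lt_le_trans ya0).
rewrite integral_itv_bndo_bndc; last first.
  apply/measurable_EFinP/measurable_funTS.
  apply: measurable_funM; first exact: measurable_powR.
  exact: clifford_powR_measurable.
have ya01 : 0 < y `^ a^-1 < 1 by rewrite ya0.
rewrite (integral_left_fun a0 ya01) /right_vec (vec_in _ y01) /right_fun -powRrM.
rewrite (_ : a^-1 * (1 + a) = (clifford_param a)^-1)//.
by rewrite /clifford_param invf_div mulrC.
Qed.

End parameter.
End kernel.

(** * The norms of T_a and T_a - T_0 *)

Section norms.
Context {R : realType}.
Notation mR := (measurableTypeR R).
Implicit Types (x y a : R) (f : L2 R).

Let mL2 f (D : set mR) : measurable_fun D (EFin \o f).
Proof. by apply/measurable_EFinP; apply: measurable_funTS. Qed.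

Lemma singular_sq_ge0 a : 0 < a -> 0 <= singular_sq a.
Proof.
move=> a0; rewrite divr_ge0 ?(ltW a0)// mulr_ge0 ?exprn_ge0 ?addr_ge0 ?(ltW a0)//.
exact/ltW/first_zero_gt0/clifford_param01.
Qed.

Lemma opnorm_T a : 0 < a -> opnorm (T a) = (Num.sqrt (singular_sq a))%:E.
Proof.
move=> a0.
apply: (@opnorm_schur R (T a) (powerT_region a) (right_vec a) (left_vec a)).
- exact: powerT_region_measurable.
- move=> f x x01; congr `| _ |.
  have /andP[x0 x1] := x01; have xa1 : x `^ a < 1 by rewrite powR_lt1// ltW.
  rewrite [LHS](_ : _ = \int[mu01 R]_(y in `[0, x `^ a]) f y)//.
  rewrite /Rintegral; congr fine.
  under [RHS]eq_integral do rewrite (congr1 (@^~ _) (powerT_region_xsection a x01)).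
  rewrite mu01_integral_indic//; last first.
    by move=> y /=; rewrite !in_itv/= => /andP[/ltW -> /le_trans -> //]; exact: ltW.
  rewrite mu01_integral_lebesgue; last first.
    by move=> y /=; rewrite !in_itv/= => /andP[-> /le_trans -> //]; exact: ltW.
  by rewrite -integral_itv_obnd_cbnd//; exact: mL2.
- by move=> x y [].
- exact: right_vec_measurable.
- exact: left_vec_measurable.
- exact: right_vec01.
- by move=> x; have /andP[] := left_vec01 a0 x.
- by move=> y y01; rewrite /right_vec vec_in//; have /andP[] := right_fun_bounds a0 y01.
- exact: powerT_region_gt0.
- exact: integral_right_vec.
- exact: integral_left_vec.
- exact: singular_sq_ge0.
Qed.

Lemma T_subr_T0 a f x : 0 < a -> 0 < x < 1 ->
  (T a f - T 0 f) x = - \int[mu01 R]_(y in `]x `^ a, 1]) f y.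
Proof.
move=> a0 /andP[x0 x1].
rewrite [LHS](_ : _ = \int[mu01 R]_(y in `[0, x `^ a]) f y -
  \int[mu01 R]_(y in `[0, x `^ 0]) f y)// powRr0.
have xa0 := powR_ge0 x a.
have xa1 : x `^ a <= 1.
  by have := ger_powR (a := x); rewrite x0 (ltW x1) => /(_ isT _ _ (ltW a0)); rewrite powRr0.
have -> : `[0, 1]%classic = `[0, x `^ a]%classic `|` `]x `^ a, 1]%classic :> set mR.
  by rewrite -itv_bndbnd_setU//= bnd_simp.
rewrite Rintegral_setU//.
- by rewrite opprD addrA subrr add0r.
- by apply: L2_integrable; exact: measurableU.
- apply/disj_setPS => y [/=]; rewrite !in_itv/= => /andP[_ yx] /andP[].
  by rewrite ltNge yx.
Qed.

(** By [T_subr_T0] the kernel of T_a - T_0 is minus the indicator of y > x^a, that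
    is of x < y^(1/a): the transpose of the kernel of T_{1/a}, up to a null set.
    Transposition exchanges u and w, up to the factor lam. *)
Lemma opnorm_T_subr_T0 a : 0 < a ->
  opnorm (T a \- T 0) = (Num.sqrt (singular_sq a^-1))%:E.
Proof.
move=> a0; have b0 : 0 < a^-1 by rewrite invr_gt0.
pose E : set (mR * mR) := [set p | powerT_region a^-1 (p.2, p.1)].
have IE x y : \1_E (x, y) = \1_(powerT_region a^-1) (y, x) :> R.
  by rewrite !indicE; congr (nat_of_bool _)%:R.
have l0 := singular_sq_ge0 b0.
have lgt0 : 0 < singular_sq a^-1.
  rewrite divr_gt0// mulr_gt0 ?exprn_gt0 ?addr_gt0//.
  exact/first_zero_gt0/clifford_param01.
apply: (@opnorm_schur R (T a \- T 0) E (left_vec a^-1)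
  (fun y => singular_sq a^-1 * right_vec a^-1 y)).
- rewrite (_ : E = (fun p : mR * mR => (p.2, p.1)) @^-1` powerT_region a^-1)//.
  rewrite -[X in measurable X]setTI.
  have : measurable_fun setT (fun p : mR * mR => (p.2, p.1)).
    by apply/measurable_fun_pair.
  by apply=> //; exact: powerT_region_measurable.
- move=> f x x01; have /andP[x0 x1] := x01.
  rewrite [X in `|X| = _](_ : _ = (T a f - T 0 f) x)//.
  rewrite (T_subr_T0 f a0 x01) normrN; congr `| _ |.
  have xa0 : 0 < x `^ a by rewrite powR_gt0.
  rewrite /Rintegral; congr fine.
  under [RHS]eq_integral do rewrite IE (congr1 (@^~ _) (powerT_region_ysection b0 x01)) invrK.
  rewrite mu01_integral_indic//; last first.
    by move=> y /=; rewrite !in_itv/= => /andP[/(lt_le_trans xa0)/ltW -> /ltW -> //].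
  rewrite mu01_integral_lebesgue; last first.
    by move=> y /=; rewrite !in_itv/= => /andP[/(lt_trans xa0)/ltW -> ->].
  rewrite integral_itv_obnd_cbnd; last exact: mL2.
  by rewrite -integral_itv_bndo_bndc//; exact: mL2.
- by move=> x y /(powerT_region01 b0)[].
- exact: left_vec_measurable.
- by apply: measurable_funM => //; exact: right_vec_measurable.
- exact: left_vec01.
- by move=> x; have /andP[r0 _] := right_vec01 b0 x; rewrite mulr_ge0.
- by move=> y y01; rewrite /left_vec vec_in//; have /andP[] := left_fun_bounds b0 y01.
- by move=> x y /(powerT_region_gt0 b0)[w0 u0]; split; [exact: mulr_gt0|].
- by move=> x; under eq_integral do rewrite IE; exact: integral_left_vec.
- move=> y; under eq_integral do rewrite IE mulrCA EFinM.
  rewrite ge0_integralZl//.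
  + by rewrite integral_right_vec.
  + apply/measurable_EFinP/measurable_funM; last exact: right_vec_measurable.
    have mK : measurable_fun setT (\1_(powerT_region a^-1) : _ -> R).
      by apply: measurable_indic; exact: powerT_region_measurable.
    by apply: (measurableT_comp mK); exact: measurable_pair1.
  + move=> x _; rewrite lee_fin mulr_ge0 ?indicE//.
    by have /andP[] := right_vec01 b0 x.
- exact: l0.
Qed.

End norms.

(** * Asymptotics *)

Section asymptotics.
Context {R : realType}.
Implicit Types (a : R).

Lemma sqrt_singular_sq a : 0 < a ->
  Num.sqrt (singular_sq a) = (1 + a)^-1 * Num.sqrt (a / clifford_root a).
Proof.
move=> a0; have a1 : 0 < 1 + a by rewrite addr_gt0.
have z0 : 0 < clifford_root a by exact/first_zero_gt0/clifford_param01.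
rewrite -[X in X * _](@ger0_norm _ _ _) ?invr_ge0 ?(ltW a1)// -sqrtr_sqr -sqrtrM ?sqr_ge0//.
by congr Num.sqrt; rewrite /singular_sq; field; rewrite !gt_eqF.
Qed.

(** Both limits of the theorem are the limit at infinity of the right-hand side,
    taken along a and along 1/a. *)
Lemma sqrt_singular_sq_rescaled a (z : R) : 0 < a -> 0 < z ->
  Num.sqrt (singular_sq a) * (Num.sqrt z * Num.sqrt a) =
  a / (1 + a) * Num.sqrt (z / clifford_root a).
Proof.
move=> a0 Z0; have z0 : 0 < clifford_root a by exact/first_zero_gt0/clifford_param01.
rewrite sqrt_singular_sq// !sqrtrM ?(ltW a0) ?(ltW Z0)//.
transitivity (Num.sqrt a ^+ 2 / (1 + a) * (Num.sqrt z * Num.sqrt (clifford_root a)^-1)).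
  by ring.
by rewrite sqr_sqrtr// ltW.
Qed.

Lemma cvg_rescaled :
  a / (1 + a) * Num.sqrt (first_zero 1 / clifford_root a) @[a --> +oo] --> (1 : R).
Proof.
have z1 : 0 < first_zero (1 : R) by apply: first_zero_gt0; rewrite ltr01 lexx.
have Z : clifford_root a @[a --> +oo] --> first_zero (1 : R) by exact: first_zero_cvg1.
have V : first_zero 1 / clifford_root a @[a --> +oo] --> first_zero (1 : R) / first_zero 1.
  by apply: cvgMl_tmp; apply: cvgV Z; exact: lt0r_neq0 z1.
have S : Num.sqrt (first_zero 1 / clifford_root a) @[a --> +oo] --> (1 : R).
  have E : Num.sqrt (first_zero (1 : R) / first_zero 1) = 1.
    by rewrite (divff (lt0r_neq0 z1)) sqrtr1.
  rewrite -[X in _ --> X]E.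
  by apply: continuous_cvg; [exact: sqrt_continuous|exact: V].
have := cvgM (@cvg_ratio1 R) S; rewrite mulr1; exact.
Qed.

(** The norm N satisfies N^2 s (1 + a) = 1 with s = c / q = 1 + a / 2 + O(a^2), so
    N^2 = (1 - 3 a / 4)^2 + O(a^2), and dividing by N + (1 - 3 a / 4) >= 1 / 2
    gives the claim.  The bound 1/8 on a keeps s above 1. *)
Lemma norm_expansion a : 0 < a <= 1 / 8 ->
  `|Num.sqrt (singular_sq a) - (1 - 3 / 4 * a)| <= 26 * a ^+ 2.
Proof.
move=> /andP[a0 a2]; have a1 : 0 < 1 + a by rewrite addr_gt0.
have z0 : 0 < clifford_root a by exact/first_zero_gt0/clifford_param01.
have := first_zero_expansion (clifford_param01 a0); rewrite -/(clifford_root a).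
have qE : clifford_param a * (1 + a) = a by rewrite /clifford_param divfK// gt_eqF.
have /andP[q0 q1] := clifford_param01 a0.
have qa : clifford_param a <= a by nra.
have qa' : a - a ^+ 2 <= clifford_param a by nra.
set s := clifford_root a / clifford_param a => Hs.
have s0 : 0 < s by rewrite divr_gt0.
have Es : `|s - (1 + a / 2)| <= 4 * a ^+ 2.
  move: Hs; rewrite !ler_norml => /andP[l u].
  have : clifford_param a ^+ 2 <= a ^+ 2 by rewrite lerXn2r ?nnegrE// ltW.
  have : 0 <= a ^+ 2 by rewrite sqr_ge0.
  move=> ? ?; apply/andP; split; lra.
have NE : Num.sqrt (singular_sq a) ^+ 2 = (s * (1 + a))^-1.
  rewrite sqr_sqrtr ?singular_sq_ge0// /singular_sq /s /clifford_param.
  by field; rewrite !gt_eqF.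
have N0 : 0 <= Num.sqrt (singular_sq a) by exact: sqrtr_ge0.
move: (Num.sqrt _) NE N0 => N NE N0.
set D := s * (1 + a) in NE.
have D0 : 1 <= D by move: Es; rewrite ler_norml => /andP[l u]; rewrite /D; nra.
have D1 : N ^+ 2 * D = 1 by rewrite NE mulVf// gt_eqF//; lra.
have De : `|D - (1 + 3 / 2 * a)| <= 9 * a ^+ 2.
  have -> : D - (1 + 3 / 2 * a) = (s - (1 + a / 2)) * (1 + a) + a ^+ 2 / 2.
    by rewrite /D; field.
  apply: le_trans (ler_normD _ _) _; rewrite normrM (gtr0_norm a1).
  rewrite [`|a ^+ 2 / 2|]ger0_norm ?divr_ge0 ?sqr_ge0//.
  have : `|s - (1 + a / 2)| * (1 + a) <= 4 * a ^+ 2 * (9 / 8).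
    by apply: ler_pM => //; [exact: ltW|lra].
  have : 0 <= a ^+ 2 by rewrite sqr_ge0.
  lra.
set M := 1 - 3 / 4 * a.
have M1 : 1 / 2 <= M <= 1 by rewrite /M; apply/andP; split; lra.
have P : `|(N - M) * ((N + M) * D)| <= 12 * a ^+ 2.
  have -> : (N - M) * ((N + M) * D) =
      - ((D - (1 + 3 / 2 * a)) * M ^+ 2 + a ^+ 2 * (27 / 32 * a - 27 / 16)).
    by rewrite mulrA -subr_sqr mulrBl D1 /M; field.
  rewrite normrN; apply: le_trans (ler_normD _ _) _.
  rewrite (normrM (D - _)) (normrM (a ^+ 2)).
  have : `|D - (1 + 3 / 2 * a)| * `|M ^+ 2| <= 9 * a ^+ 2 * 1.
    apply: ler_pM => //; rewrite ger0_norm ?sqr_ge0// expr_le1//; lra.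
  rewrite (ger0_norm (sqr_ge0 a)) [`|27 / 32 * a - _|]ler0_norm; last by lra.
  have : a ^+ 2 * - (27 / 32 * a - 27 / 16) <= a ^+ 2 * 2.
    by rewrite ler_wpM2l ?sqr_ge0//; lra.
  have : 0 <= a ^+ 2 by rewrite sqr_ge0.
  lra.
have Q : 1 / 2 <= (N + M) * D by nra.
rewrite normrM (ger0_norm (le_trans _ Q)) in P; last by lra.
have : `|N - M| * (1 / 2) <= `|N - M| * ((N + M) * D) by rewrite ler_wpM2l.
have : 0 <= a ^+ 2 by rewrite sqr_ge0.
lra.
Qed.

End asymptotics.

Theorem corollary1 (R : realType) :
  exists (h0 : R -> R) (h0oo : R),
    (forall a : R, 0 < a -> smallest_positive_zero (H a) (h0 a)) /\
    smallest_positive_zero (@Hoo R) h0oo /\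
    (1445 / 10 ^+ 3 + 796 / 10 ^+ 6 <= h0oo < 1445 / 10 ^+ 3 + 797 / 10 ^+ 6) /\
    (forall a : R, 0 < a ->
       opnorm (T a) = ((1 + a)^-1 * Num.sqrt (a / h0 a))%:E) /\
    (fine (opnorm (T a)) / ((Num.sqrt h0oo)^-1 / Num.sqrt a)
       @[a --> +oo] --> (1 : R)) /\
    (fine (opnorm (T a \- T 0)) / Num.sqrt (a / h0oo)
       @[a --> (0 : R)^'+] --> (1 : R)) /\
    (fun a : R => fine (opnorm (T a)) - (1 - 3 / 4 * a))
      =O_ (0^'+) (fun a : R => a ^+ 2).
Proof.
have z1 : 0 < first_zero (1 : R) by apply: first_zero_gt0; rewrite ltr01 lexx.
exists clifford_root, (first_zero 1); split; [|split; [|split; [|split; [|split; [|split]]]]].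
- by move=> a a0; rewrite H_clifford//; exact/first_zeroP/clifford_param01.
- by rewrite Hoo_clifford; apply: first_zeroP; rewrite ltr01 lexx.
- exact: first_zero_1_bounds.
- by move=> a a0; rewrite opnorm_T// sqrt_singular_sq.
- apply: cvg_trans cvg_rescaled; apply: near_eq_cvg; near=> a.
  have a0 : 0 < a by [].
  rewrite opnorm_T//= -(sqrt_singular_sq_rescaled a0 z1).
  by rewrite invf_div invrK mulrC [in RHS]mulrC [in RHS](mulrC (Num.sqrt a)).
- have cV : a^-1 @[a --> (0 : R)^'+] --> +oo.
    apply/gtr0_cvgV0; first by near=> a; rewrite invr_gt0.
    under eq_cvg do rewrite /= invrK.
    by apply: cvg_at_right_filter; exact: cvg_id.
  apply: cvg_trans (cvg_comp _ _ cV cvg_rescaled); apply: near_eq_cvg; near=> a.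
  have a0 : 0 < a by [].
  rewrite opnorm_T_subr_T0//= -(sqrt_singular_sq_rescaled _ z1) ?invr_gt0//.
  congr (_ * _); rewrite -sqrtrV ?divr_ge0 ?(ltW a0) ?(ltW z1)// invf_div.
  by rewrite sqrtrM// ltW.
- apply/eqOP; near=> k; near=> a.
  have a0 : 0 < a by [].
  rewrite opnorm_T//= (le_trans (norm_expansion _))//.
    by rewrite a0/=; near: a; apply: nbhs_right_le; lra.
  by rewrite ger0_norm ?sqr_ge0// ler_wpM2r ?sqr_ge0.
Unshelve. all: by end_near. Qed.
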